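(* Let $1\le p\le\infty$, let $p'$ be the conjugate exponent of $p$, let $(V,V^+,\Vert\cdot\Vert)$ be a complete order smooth $p$-normed space, and let $W$ be a closed subspace of $V$. Then: (i) $(W^\perp,W^{\perp+},\Vert\cdot\Vert)$ is an order smooth $p'$-normed space if and only if $(V^{**}/W^{\perp\perp},(V^{**}/W^{\perp\perp})^+,\Vert\cdot\Vert)$ is an order smooth $p$-normed space satisfying $(OS.p.2)$. (ii) If $(V^*/W^\perp,(V^*/W^\perp)^+,\Vert\cdot\Vert)$ is an order smooth $p'$-normed space, then $(W^{\perp\perp},W^{\perp\perp+},\Vert\cdot\Vert)$ is an order smooth $p$-normed space satisfying $(OS.p.2)$. (iii) Assume that $\varphi_{W^\perp}(V^{*+})=\overline{\varphi_{W^\perp}(V^{*+})}^{w^*}$. If $(W^{\perp\perp},W^{\perp\perp+},\Vert\cdot\Vert)$ is an order smooth $p$-normed space, then $(V^*/W^\perp,(V^*/W^\perp)^+,\Vert\cdot\Vert)$ is an order smooth $p'$-normed space.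
   Context: A cone in a real vector space is a set $C$ with $\lambda x+y\in C$ for $x,y\in C$, $\lambda\ge 0$; it is proper if $C\cap(-C)=\{0\}$. For a cone $V^+$ in $V$, write $x\le y$ if $y-x\in V^+$; $V^+$ is generating if $V=V^+-V^+$. Conjugate exponents: $1/p+1/p'=1$, with $1'=\infty$, $\infty'=1$. Let $V$ be a real normed space with a cone $V^+$ that is proper, generating and norm closed. For $1\le p<\infty$ consider the conditions: $(O.p.1)$: $u\le v\le w$ implies $\Vert v\Vert\le(\Vert u\Vert^p+\Vert w\Vert^p)^{1/p}$; $(O.p.2)$: for every $v\in V$ and $\epsilon>0$ there are $v_1,v_2\in V^+$ with $v=v_1-v_2$ and $(\Vert v_1\Vert^p+\Vert v_2\Vert^p)^{1/p}<\Vert v\Vert+\epsilon$; $(OS.p.2)$: for every $v\in V$ there are $v_1,v_2\in V^+$ with $v=v_1-v_2$ and $(\Vert v_1\Vert^p+\Vert v_2\Vert^p)^{1/p}\le\Vert v\Vert$. For $p=\infty$, replace $(a^p+b^p)^{1/p}$ by $\max\{a,b\}$. $(V,V^+,\Vert\cdot\Vert)$ is an order smooth $p$-normed space if $V^+$ is proper, generating and closed and $(O.p.1)$ and $(O.p.2)$ hold. For an ordered normed space $V$, the dual cone on $V^*$ is $V^{*+}=\{f\in V^*: f(v)\ge0\ \forall v\in V^+\}$, and similarly $V^{**+}=\{F\in V^{**}:F(f)\ge0\ \forall f\in V^{*+}\}$. For a closed subspace $W$ of $V$: $W^\perp=\{f\in V^*: f|_W=0\}$ with $W^{\perp+}=W^\perp\cap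 V^{*+}$; $W^{\perp\perp}=\{F\in V^{**}:F|_{W^\perp}=0\}$ with $W^{\perp\perp+}=W^{\perp\perp}\cap V^{**+}$; $\varphi_{W^\perp}:V^*\to V^*/W^\perp$ and $\varphi_{W^{\perp\perp}}:V^{**}\to V^{**}/W^{\perp\perp}$ are the quotient maps, quotients carrying the quotient norm. The quotient cones are $(V^*/W^\perp)^+=\overline{\varphi_{W^\perp}(V^{*+})}^{w^*}$ (weak$^*$ closure, identifying $V^*/W^\perp$ with $W^*$) and $(V^{**}/W^{\perp\perp})^+=\overline{\varphi_{W^{\perp\perp}}(V^{**+})}^{w^*}$ (weak$^*$ closure, identifying $V^{**}/W^{\perp\perp}$ with $(W^\perp)^*$). *)

(* Defs.v *)
From HB Require Import structures.
From mathcomp Require Import all_boot all_order all_algebra.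
From mathcomp Require Import all_classical all_reals all_analysis.

Set Implicit Arguments.
Unset Strict Implicit.
Unset Printing Implicit Defensive.

Import Order.TTheory GRing.Theory Num.Theory.
Import numFieldNormedType.Exports.

Local Open Scope classical_set_scope.
Local Open Scope quotient_scope.
Local Open Scope ring_scope.

Section OrderSmooth.
Context {R : realType} {E : normedModType R}.
Implicit Types (p : \bar R) (C : set E).

(* The l^p norm of (a, b); the value at -oo is irrelevant. *)
Definition lpnorm2 p (a b : R) : R :=
  match p with
  | r%:E => (a `^ r + b `^ r) `^ r^-1
  | +oo%E => Num.max a b
  | -oo%E => 0
  end.

Definition cone C :=
  forall (l : R) x y, 0 <= l -> C x -> C y -> C (l *: x + y).

Definition proper_cone C := C `&` -%R @` C = [set 0].

Definition generating_cone C := [set x - y | x in C & y in C] = setT.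

Definition cone_le C (x y : E) := C (y - x).

Definition Op1 p C := forall u v w : E,
  cone_le C u v -> cone_le C v w -> `|v| <= lpnorm2 p `|u| `|w|.

Definition Op2 p C := forall (v : E) (e : R), 0 < e ->
  exists v1 v2, [/\ C v1, C v2, v = v1 - v2 &
                    lpnorm2 p `|v1| `|v2| < `|v| + e].

Definition OSp2 p C := forall v : E,
  exists v1 v2, [/\ C v1, C v2, v = v1 - v2 &
                    lpnorm2 p `|v1| `|v2| <= `|v|].

Record order_smooth p C : Prop := OrderSmooth {
  order_smooth_cone : cone C;
  order_smooth_proper : proper_cone C;
  order_smooth_generating : generating_cone C;
  order_smooth_closed : closed C;
  order_smooth_Op1 : Op1 p C;
  order_smooth_Op2 : Op2 p C
}.

End OrderSmooth.

Section Dual.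
Context {R : realType} (E : normedModType R).

Definition contlin : {pred E -> R^o} :=
  mem [set f : E -> R^o | linear f /\ continuous f].

Lemma contlin_submod_closed : submod_closed contlin.
Proof.
split.
  rewrite inE; split; first by move=> a x y; rewrite /= scaler0 addr0.
  by move=> x; exact: cvg_cst.
move=> a f g; rewrite !inE => -[lf cf] [lg cg]; split.
  by move=> b x y; rewrite !fctE lf lg !scalerDr !scalerA (mulrC b a) addrACA.
move=> x; apply: (@cvgD _ R^o); last exact: cg.
by apply: (@cvgZl_tmp _ R^o); exact: cf.
Qed.

HB.instance Definition _ :=
  GRing.isSubmodClosed.Build R (E -> R^o) contlin contlin_submod_closed.

Record dual := Dual { dual_val :> E -> R^o; dual_valP : dual_val \in contlin }.

HB.instance Definition _ := [isSub for dual_val].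
HB.instance Definition _ := [Choice of dual by <:].
HB.instance Definition _ := [SubChoice_isSubLmodule of dual by <:].

Implicit Types f g : dual.

Lemma dual_linear f : linear f.
Proof. by have := dual_valP f; rewrite inE => -[]. Qed.

HB.instance Definition _ f :=
  GRing.isLinear.Build R E R^o *:%R (dual_val f) (dual_linear f).

Lemma dual_continuous f : continuous f.
Proof. by have := dual_valP f; rewrite inE => -[]. Qed.

Definition opnorm f : R := sup [set `|f x| | x in [set x : E | `|x| <= 1]].

Let opnorm_has_sup f :
  has_sup [set `|f x| | x in [set x : E | `|x| <= 1]].
Proof.
split; first by exists `|f 0|, 0 => //=; rewrite normr0.
have /linear_bounded_continuous/linear_boundedP := @dual_continuous f.
move=> /pinfty_ex_gt0[r r0 fr]; exists r => _ [x /= x1 <-].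
by rewrite (le_trans (fr x))// ler_piMr// ltW.
Qed.

Lemma opnorm_ub f x : `|f x| <= opnorm f * `|x|.
Proof.
have [->|x0] := eqVneq x 0; first by rewrite linear0 !normr0 mulr0.
have nx0 : 0 < `|x| by rewrite normr_gt0.
have -> : x = `|x| *: (`|x|^-1 *: x) by rewrite scalerA divff ?gt_eqF// scale1r.
rewrite linearZ/= !normrZ normr_id normfV normr_id mulVf ?gt_eqF// mulr1 mulrC.
rewrite ler_wpM2r//; apply: sup_upper_bound => //.
by exists (`|x|^-1 *: x) => //=; rewrite normfZV.
Qed.

Lemma ler_opnormD f g : opnorm (f + g) <= opnorm f + opnorm g.
Proof.
apply: ge_sup; first by case: (opnorm_has_sup (f + g)).
move=> _ [x /= x1 <-]; rewrite (le_trans (ler_normD _ _))// lerD//.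
  by apply: sup_upper_bound => //; exists x.
by apply: sup_upper_bound => //; exists x.
Qed.

Lemma opnorm_eq0 f : opnorm f = 0 -> f = 0.
Proof.
move=> f0; apply/val_inj/funext => x; apply/eqP; rewrite -normr_le0.
by rewrite (le_trans (opnorm_ub f x))// f0 mul0r.
Qed.

Let ler_opnormZ (l : R) f : opnorm (l *: f) <= `|l| * opnorm f.
Proof.
apply: ge_sup; first by case: (opnorm_has_sup (l *: f)).
move=> _ [x /= x1 <-]; rewrite normrZ ler_wpM2l//.
by apply: sup_upper_bound => //; exists x.
Qed.

Lemma opnormZ (l : R) f : opnorm (l *: f) = `|l| * opnorm f.
Proof.
apply/eqP; rewrite eq_le ler_opnormZ/=.
have [->|l0] := eqVneq l 0.
  rewrite normr0 mul0r scale0r.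
  rewrite (le_trans (normr_ge0 ((0 : dual) 0)))//.
  by apply: sup_upper_bound => //; exists 0 => //=; rewrite normr0.
have := ler_opnormZ l^-1 (l *: f); rewrite scalerA mulVf// scale1r normfV.
by rewrite ler_pdivlMl// normr_gt0.
Qed.

HB.instance Definition _ :=
  Lmodule_isNormed.Build R dual ler_opnormD opnormZ opnorm_eq0.

End Dual.
Arguments contlin {R} E.
Arguments dual_val {R E}.

Record closedSubmod (R : realType) (E : normedModType R) := ClosedSubmod {
  submod_pred :> {pred E};
  submod_predP : submod_closed submod_pred;
  submod_pred_closed : closed [set` submod_pred]
}.

HB.instance Definition _ (R : realType) (E : normedModType R)
    (W : closedSubmod E) :=
  GRing.isSubmodClosed.Build R E (submod_pred W) (submod_predP W).

Section Subspace.
Context {R : realType} {E : normedModType R} (W : closedSubmod E).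

Record csub := CSub { csub_val : E; csub_valP : csub_val \in W }.

HB.instance Definition _ := [isSub for csub_val].
HB.instance Definition _ := [Choice of csub by <:].
HB.instance Definition _ := [SubChoice_isSubLmodule of csub by <:].

Definition csub_norm (x : csub) : R := `|val x|.

Lemma csub_normD x y : csub_norm (x + y) <= csub_norm x + csub_norm y.
Proof. by rewrite /csub_norm raddfD ler_normD. Qed.

Lemma csub_normZ (l : R) x : csub_norm (l *: x) = `|l| * csub_norm x.
Proof. by rewrite /csub_norm linearZ normrZ. Qed.

Lemma csub_norm_eq0 x : csub_norm x = 0 -> x = 0.
Proof. by move=> /normr0_eq0 x0; apply: val_inj. Qed.

HB.instance Definition _ :=
  Lmodule_isNormed.Build R csub csub_normD csub_normZ csub_norm_eq0.

Lemma csub_normE (x : csub) : `|x| = `|val x|.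
Proof. by []. Qed.

Lemma csub_val_continuous : continuous (val : csub -> E).
Proof.
apply: (@bounded_linear_continuous R csub E (val : {linear csub -> E})).
by apply/linear_boundedP; near=> r => x; rewrite ler_peMl.
Unshelve. all: by end_near. Qed.

Definition csub_cone (C : set E) : set csub := val @^-1` C.

End Subspace.
Arguments csub_cone {R E} W C.

Section Quotient.
Context {R : realType} {E : normedModType R} (W : closedSubmod E).

(* Quotient.quot only needs W to be an additive subgroup; the linear structure
   and the quotient norm are added below. *)
Definition cquot := Quotient.quot (submod_pred W).

HB.instance Definition _ := GRing.Zmodule.on cquot.
HB.instance Definition _ := EqQuotient.on cquot.

Definition cproj (x : E) : cquot := \pi_cquot x.

Lemma cprojP (x y : E) : cproj x = cproj y <-> x - y \in W.
Proof.
rewrite Quotient.idealrBE; split=> [h|/eqP//]; exact/eqP.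
Qed.

Lemma cproj_repr (q : cquot) : cproj (repr q) = q.
Proof. exact: reprK. Qed.

Let cprojD (x y : E) : cproj (x + y) = cproj x + cproj y.
Proof. exact: (raddfD \pi_(Quotient.quot W)). Qed.

Definition cquot_scale (l : R) (q : cquot) : cquot := cproj (l *: repr q).

Let cproj_scale (l : R) (x : E) : cquot_scale l (cproj x) = cproj (l *: x).
Proof.
by apply/cprojP; rewrite -scalerBr rpredZ//; apply/cprojP; exact: cproj_repr.
Qed.

Lemma cquot_scaleA (a b : R) (q : cquot) :
  cquot_scale a (cquot_scale b q) = cquot_scale (a * b) q.
Proof. by rewrite -[q]cproj_repr !cproj_scale scalerA. Qed.

Lemma cquot_scale1 : left_id 1 cquot_scale.
Proof. by move=> q; rewrite -[q]cproj_repr cproj_scale scale1r. Qed.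

Lemma cquot_scaleDr : right_distributive cquot_scale +%R.
Proof.
move=> a q q'; rewrite -[q]cproj_repr -[q']cproj_repr.
by rewrite -cprojD !cproj_scale scalerDr cprojD.
Qed.

Lemma cquot_scaleDl (q : cquot) : {morph cquot_scale^~ q : a b / a + b}.
Proof.
by move=> a b; rewrite -[q]cproj_repr !cproj_scale scalerDl cprojD.
Qed.

HB.instance Definition _ := GRing.Zmodule_isLmodule.Build R cquot
  cquot_scaleA cquot_scale1 cquot_scaleDr cquot_scaleDl.

Lemma cproj_linear : linear cproj.
Proof. by move=> a x y; rewrite cprojD -cproj_scale. Qed.

HB.instance Definition _ :=
  GRing.isLinear.Build R E cquot *:%R cproj cproj_linear.

Definition quot_norm (q : cquot) : R :=
  inf [set `|x| | x in [set x | cproj x = q]].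

Let has_inf_quot_norm (q : cquot) :
  has_inf [set `|x| | x in [set x | cproj x = q]].
Proof.
split; first by exists `|repr q|, (repr q) => //=; exact: cproj_repr.
by exists 0 => _ [x _ <-].
Qed.

Let quot_norm_lb (x : E) : quot_norm (cproj x) <= `|x|.
Proof. by apply: ge_inf; [case: (has_inf_quot_norm (cproj x))|exists x]. Qed.

Let quot_norm_adherent (q : cquot) (e : R) : 0 < e ->
  exists2 x, cproj x = q & `|x| < quot_norm q + e.
Proof.
move=> e0; have [_ [x xq <-] xe] := inf_adherent e0 (has_inf_quot_norm q).
by exists x.
Qed.

Lemma quot_normD (q q' : cquot) :
  quot_norm (q + q') <= quot_norm q + quot_norm q'.
Proof.
apply/ler_addgt0Pr => e e0; have e20 : 0 < e / 2 by rewrite divr_gt0.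
have [x <- xe] := quot_norm_adherent q e20.
have [y <- ye] := quot_norm_adherent q' e20.
rewrite -raddfD (le_trans (quot_norm_lb _))// (le_trans (ler_normD _ _))//.
by rewrite (splitr e) addrACA lerD// ltW.
Qed.

Let quot_norm_ge0 (q : cquot) : 0 <= quot_norm q.
Proof.
apply: lb_le_inf; first by case: (has_inf_quot_norm q).
by move=> _ [x _ <-].
Qed.

Let ler_quot_normZ (l : R) (q : cquot) :
  quot_norm (l *: q) <= `|l| * quot_norm q.
Proof.
apply/ler_addgt0Pr => e e0.
have e1 : 0 < e / (`|l| + 1) by rewrite divr_gt0// ltr_wpDl.
have [x <- xe] := quot_norm_adherent q e1.
rewrite -linearZ (le_trans (quot_norm_lb _))// normrZ.
rewrite (le_trans (ler_wpM2l _ (ltW xe)))// mulrDr lerD2l.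
by rewrite mulrCA ler_piMr// ?ltW// ltr_pdivrMr ?ltr_wpDl// mul1r ltrDl.
Qed.

Lemma quot_normZ (l : R) (q : cquot) : quot_norm (l *: q) = `|l| * quot_norm q.
Proof.
apply/eqP; rewrite eq_le ler_quot_normZ/=.
have [->|l0] := eqVneq l 0; first by rewrite normr0 mul0r.
have := ler_quot_normZ l^-1 (l *: q); rewrite scalerA mulVf// scale1r normfV.
by rewrite ler_pdivlMl// normr_gt0.
Qed.

Lemma quot_norm_eq0 (q : cquot) : quot_norm q = 0 -> q = 0.
Proof.
move=> q0; rewrite -[q]cproj_repr -(raddf0 cproj); apply/cprojP; rewrite subr0.
suff : closure [set` W] (repr q) by move/submod_pred_closed.
move=> B /nbhs_normP[e /= e0 eB].
have [x xq xe] := quot_norm_adherent q e0.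
exists (repr q - x); split; first by apply/cprojP; rewrite cproj_repr.
by apply: eB => /=; rewrite opprB addrC subrK -[e]add0r -q0.
Qed.

HB.instance Definition _ :=
  Lmodule_isNormed.Build R cquot quot_normD quot_normZ quot_norm_eq0.

End Quotient.

Section DualCone.
Context {R : realType} {E : normedModType R}.

Definition dual_cone (C : set E) : set (dual E) :=
  [set f | forall x, C x -> 0 <= f x].

Definition annihilator_pred (W : closedSubmod E) : {pred dual E} :=
  mem [set f : dual E | forall x, x \in W -> f x = 0].

Lemma annihilator_submod_closed (W : closedSubmod E) :
  submod_closed (annihilator_pred W).
Proof.
split; first by rewrite inE.
move=> a f g; rewrite !inE => f0 g0 x xW.
by rewrite [LHS](_ : _ = a *: f x + g x)// f0// g0// scaler0 addr0.
Qed.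

Lemma annihilator_closed (W : closedSubmod E) :
  closed [set` annihilator_pred W].
Proof.
move=> f clf; rewrite /= inE => x xW; apply/eqP; rewrite -normr_le0.
apply/ler_addgt0Pr => e e0; rewrite add0r.
have e1 : 0 < e / (`|x| + 1) by rewrite divr_gt0// ltr_wpDl.
have [g [/=]] := clf _ (nbhsx_ballx f _ e1).
rewrite inE => g0; rewrite -ball_normE /= => fg.
have -> : f x = (f - g) x by rewrite [RHS](_ : _ = f x - g x)// g0// subr0.
rewrite (le_trans (opnorm_ub _ _))// (le_trans (ler_wpM2r _ (ltW fg)))//.
by rewrite mulrAC -mulrA ler_piMr ?ltW// ltr_pdivrMr ?ltr_wpDl// mul1r ltrDl.
Qed.

Definition annihilator (W : closedSubmod E) : closedSubmod (dual E) :=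
  ClosedSubmod (annihilator_submod_closed W) (@annihilator_closed W).

Definition weak_star : Type :=
  initial_topology (dual_val : dual E -> {ptws E -> R^o}).
HB.instance Definition _ := Topological.on weak_star.

Definition weak_star_closure (A : set (dual E)) : set (dual E) :=
  closure (A : set weak_star).

End DualCone.
Arguments weak_star {R} E.

Section QuotientCone.
Context {R : realType} {E : normedModType R} (W : closedSubmod E).

Lemma dual_restrict_contlin (f : dual E) :
  (fun w : csub W => f (val w)) \in contlin (csub W).
Proof.
rewrite inE; split; first by move=> a x y /=; rewrite !linearP.
move=> x; apply: (@continuous_comp (csub W) E R^o val f).
  exact: csub_val_continuous.
exact: dual_continuous.
Qed.

Definition dual_restrict (f : dual E) : dual (csub W) :=
  Dual (dual_restrict_contlin f).

(* The canonical identification of E^* / W^perp with W^*: the class of f is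
   sent to the restriction of f to W (quot_restrict_cproj). *)
Definition quot_restrict (q : cquot (annihilator W)) : dual (csub W) :=
  dual_restrict (repr q).

Lemma eq_restrict (f g : dual E) :
  dual_restrict f = dual_restrict g <->
  cproj (annihilator W) f = cproj (annihilator W) g.
Proof.
split=> [fg|/cprojP].
  apply/cprojP; rewrite inE => x xW.
  have := congr1 (fun h : dual (csub W) => h (CSub xW)) fg.
  by rewrite /= [LHS in _ -> LHS = _](_ : _ = f x - g x)// => ->; rewrite subrr.
rewrite inE => fg; apply/val_inj/funext => -[x xW] /=.
by apply/eqP; rewrite -subr_eq0; apply/eqP; exact: fg xW.
Qed.

Lemma quot_restrict_cproj (f : dual E) :
  quot_restrict (cproj (annihilator W) f) = dual_restrict f.
Proof. by apply/eq_restrict; exact: cproj_repr. Qed.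

Lemma quot_restrict_inj : injective quot_restrict.
Proof.
by move=> q q' /eq_restrict; rewrite !cproj_repr.
Qed.

(* The weak-* closure of the image of C in E^* / W^perp, computed in W^* and
   pulled back along the identification. *)
Definition quot_cone (C : set (dual E)) : set (cquot (annihilator W)) :=
  quot_restrict @^-1`
    weak_star_closure (quot_restrict @` (cproj (annihilator W) @` C)).

End QuotientCone.
Arguments quot_cone {R E} W C.

(* Main.v *)
(* For conjugate exponents the conditions (O.p.1) and (O.p'.2) are dual to each
   other: each of them, for a closed cone in a complete space, is equivalent to
   the other one for the dual cone, and (O.p.1) even yields (OS.p'.2) on the
   dual. All four implications follow from the Mazur-Orlicz form of the
   Hahn-Banach theorem, together with a successive approximation to pass from
   almost decomposing a vector to decomposing it.

   By separation, the weak* closed cone of V^*/W^perp is the dual cone of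
   W `&` V^+ in W^*, and likewise V^**/W^perpperp is the ordered dual of W^perp,
   which gives (i). Dually, W^perpperp is the dual of V^*/W^perp. Its cone is
   the dual of phi(V^{*+}), which contains the dual of the weak* closure, so
   (OS.p.2) still passes to it in (ii), whereas (O.p.1) is inherited from V^**;
   in (iii) the two cones agree by assumption. *)
From HB Require Import structures.
Require Import Defs.
From mathcomp Require Import all_boot all_order all_algebra.
From mathcomp Require Import all_classical all_reals all_analysis.
From mathcomp Require Import ring lra.

Set Implicit Arguments.
Unset Strict Implicit.
Unset Printing Implicit Defensive.

Import Order.TTheory GRing.Theory Num.Theory.
Import numFieldNormedType.Exports.

Local Open Scope classical_set_scope.
Local Open Scope ring_scope.

(** * Sublinear functionals *)
Section MazurOrlicz.
Context {R : realType} {E : lmodType R}.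
Implicit Types (P Q : E -> R) (K : E -> R -> Prop).

Definition sublinear P :=
  (forall x y, P (x + y) <= P x + P y) /\
  (forall (a : R) x, 0 <= a -> P (a *: x) <= a * P x).

Lemma sublinear0 P : sublinear P -> P 0 = 0.
Proof.
case=> PD PZ; have := PZ 0 0 (lexx _); have := PD 0 0.
rewrite scale0r addr0; lra.
Qed.

Lemma sublinearN_ge P x : sublinear P -> - P (- x) <= P x.
Proof.
by move=> sP; have := sP.1 x (- x); rewrite subrr sublinear0//; lra.
Qed.

(** A convex cone in [E * R]. A pair with [K x t] stands for the constraint [t <= f x] on a linear
    functional [f] to be found. *)
Definition epicone K := [/\ K 0 0,
  (forall x y s t, K x s -> K y t -> K (x + y) (s + t)) &
  (forall a x s, 0 <= a -> K x s -> K (a *: x) (a * s))].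

(** The inf-convolution lies below [P] and is at most [- t] at [- k] for every constraint [K k t],
    so a linear functional below it satisfies all the constraints. *)
Definition infconv P K x :=
  inf [set r | exists k t, K k t /\ r = P (x + k) - t].

Section infconv.
Variables (P : E -> R) (K : E -> R -> Prop).
Hypotheses (sP : sublinear P) (cK : epicone K).
Hypothesis PK : forall x t, K x t -> t <= P x.

Lemma infconv_le x k t : K k t -> infconv P K x <= P (x + k) - t.
Proof.
move=> Kk; apply: ge_inf; last by exists k, t.
(* The infimum is finite because [t' <= P k' <= P (x + k') + P (- x)]. *)
exists (- P (- x)) => _ [k' [t' [Kk' ->]]].
have := sP.1 (x + k') (- x); rewrite addrAC subrr add0r.
by have := PK Kk'; lra.
Qed.

Lemma infconv_ge x r :
  (forall k t, K k t -> r <= P (x + k) - t) -> r <= infconv P K x.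
Proof.
move=> h; apply: lb_le_inf.
  by case: cK => K0 _ _; exists (P (x + 0) - 0), 0, 0.
by move=> _ [k [t [Kk ->]]]; exact: h.
Qed.

Lemma infconv_le_self x : infconv P K x <= P x.
Proof. by case: cK => /(infconv_le x); rewrite addr0 subr0. Qed.

Lemma infconv_oppr k t : K k t -> infconv P K (- k) <= - t.
Proof. by move=> /(infconv_le (- k)); rewrite addNr sublinear0// add0r. Qed.

Lemma infconv_sublinear : sublinear (infconv P K).
Proof.
case: (cK) => K0 KD KZ; split.
  move=> x y; rewrite -lerBlDl; apply: infconv_ge => k t Kk.
  rewrite lerBlDl -lerBlDr; apply: infconv_ge => k' t' Kk'.
  have := infconv_le (x + y) (KD _ _ _ _ Kk' Kk).
  by have := sP.1 (x + k') (y + k); rewrite addrACA; lra.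
move=> a x; rewrite le_eqVlt => /predU1P[<-|a0].
  by rewrite scale0r mul0r -[leRHS]oppr0 -(oppr0 E) infconv_oppr.
rewrite -ler_pdivrMl//; apply: infconv_ge => k t Kk; rewrite ler_pdivrMl//.
apply: (le_trans (infconv_le _ (KZ a _ _ (ltW a0) Kk))).
by rewrite -scalerDr mulrBr lerB// sP.2// ltW.
Qed.

End infconv.

Lemma ray_epicone x r : epicone (fun y t => exists2 a, 0 <= a &
  y = a *: x /\ t = a * r).
Proof.
split; first by exists 0; rewrite // scale0r mul0r.
  move=> y z s t [a a0 [-> ->]] [b b0 [-> ->]]; exists (a + b).
    exact: addr_ge0.
  by rewrite scalerDl mulrDl.
move=> a y s a0 [b b0 [-> ->]]; exists (a * b); first exact: mulr_ge0.
by rewrite scalerA mulrA.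
Qed.

(* Zorn's lemma gives a minimal sublinear [Q <= P]; comparing [Q] with its
   inf-convolution along the ray spanned by [y] forces [Q] to be additive. *)
Lemma sublinear_linear P : sublinear P ->
  exists f : {linear E -> R^o}, forall x, f x <= P x.
Proof.
move=> sP; pose T := {Q : E -> R | sublinear Q /\ forall x, Q x <= P x}.
(* The order is reversed, so that a maximal element in Zorn's lemma is a minimal sublinear
   functional. *)
pose le (Q1 Q2 : T) := `[< forall x, sval Q2 x <= sval Q1 x >].
have Tlb (Q : T) x : - P (- x) <= sval Q x.
  case: Q => Q /= [sQ QP]; apply: le_trans (sublinearN_ge x sQ).
  by rewrite lerN2.
have [|Q1 Q2 Q3 /asboolP h1 /asboolP h2|[Q1 ?] [Q2 ?] /asboolP/= h1 /asboolP/= h2|A totA|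
  [Q [sQ QP]] Qmin] := @Zorn T le.
- by move=> Q; apply/asboolP => x.
- by apply/asboolP => x; apply: le_trans (h1 x).
- by apply/eq_exist/funext => x; apply/eqP; rewrite eq_le h1 h2.
- have [A0|/set0P[Q0 AQ0]] := eqVneq A set0.
    by exists (exist _ P (conj sP (fun=> lexx _))) => Q; rewrite A0.
  pose S x := inf [set sval Q x | Q in A].
  have Sle (Q : T) x : A Q -> S x <= sval Q x.
    move=> AQ; apply: ge_inf; last by exists Q.
    by exists (- P (- x)) => _ [Q' _ <-].
  have Sge x r : (forall Q : T, A Q -> r <= sval Q x) -> r <= S x.
    move=> h; apply: lb_le_inf; first by exists (sval Q0 x), Q0.
    by move=> _ [Q AQ <-]; exact: h.
  have sS : sublinear S.
    split=> [x y|a x].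
      rewrite -lerBlDl; apply: (Sge) => Q1 AQ1.
      rewrite lerBlDl -lerBlDr; apply: (Sge) => Q2 AQ2; rewrite lerBlDr.
      (* Subadditivity of an infimum needs the chain: the smaller of [Q1] and [Q2] is used at both
         points. *)
      have [/asboolP h|/asboolP h] := totA _ _ AQ1 AQ2.
        apply: (le_trans (Sle _ _ AQ2)).
        by rewrite (le_trans ((svalP Q2).1.1 _ _))// lerD2l h.
      apply: (le_trans (Sle _ _ AQ1)).
      by rewrite (le_trans ((svalP Q1).1.1 _ _))// lerD2r h.
    rewrite le_eqVlt => /predU1P[<-|a0].
      rewrite scale0r mul0r; apply: (le_trans (Sle _ _ AQ0)).
      by rewrite (sublinear0 (svalP Q0).1).
    rewrite -ler_pdivrMl//; apply: (Sge) => Q AQ; rewrite ler_pdivrMl//.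
    by apply: (le_trans (Sle _ _ AQ)); apply: (svalP Q).1.2; exact: ltW.
  have SP x : S x <= P x by apply: le_trans (Sle _ _ AQ0) ((svalP Q0).2 x).
  by exists (exist _ S (conj sS SP)) => Q AQ; apply/asboolP => x; exact: Sle.
have QD x y : Q (x + y) = Q x + Q y.
  pose K := fun z t => exists2 a, 0 <= a & z = a *: y /\ t = a * Q y.
  have cK : epicone K := ray_epicone y (Q y).
  have QK z t : K z t -> t <= Q z.
    move=> [a + [-> ->]]; rewrite le_eqVlt => /predU1P[<-|a0].
      by rewrite mul0r scale0r sublinear0.
    rewrite -ler_pdivlMl//; apply: le_trans (sQ.2 _ _ _).
      by rewrite scalerA mulVf ?gt_eqF// scale1r.
    by rewrite invr_ge0 ltW.
  have sI := infconv_sublinear sQ cK QK.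
  have IP z : infconv Q K z <= P z.
    exact: le_trans (infconv_le_self sQ cK QK z) (QP z).
  have /(congr1 sval)/= QE := Qmin (exist _ _ (conj sI IP))
    (introT (asboolP _) (infconv_le_self sQ cK QK)).
  have Ky : K y (Q y) by exists 1; rewrite // scale1r mul1r.
  apply/eqP; rewrite eq_le sQ.1/=.
  by rewrite -lerBrDr -{1}QE (infconv_le sQ QK).
have QN x : Q (- x) = - Q x.
  by apply/eqP; rewrite -addr_eq0 -QD addNr sublinear0.
have QZp a x : 0 <= a -> Q (a *: x) = a * Q x.
  move=> a0; apply/eqP; rewrite eq_le sQ.2//=.
  by have := sQ.2 a (- x) a0; rewrite scalerN !QN mulrN lerN2.
have lQ : linear (Q : E -> R^o).
  move=> a x y; rewrite QD; congr (_ + _).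
  have [a0|a0] := leP 0 a; first exact: QZp.
  by rewrite -[a]opprK scaleNr QN QZp ?oppr_ge0 1?ltW// scaleNr.
pose lin := GRing.isLinear.Build R E R^o *:%R (Q : E -> R^o) lQ.
pose f : {linear E -> R^o} := HB.pack (Q : E -> R^o) lin.
by exists f.
Qed.

(** The source of the Hahn-Banach arguments below: norm bounds enter through [P], positivity and
    prescribed values through [K]. *)
Lemma mazur_orlicz P K : sublinear P -> epicone K ->
  (forall x t, K x t -> t <= P x) ->
  exists f : {linear E -> R^o},
    (forall x, f x <= P x) /\ (forall x t, K x t -> t <= f x).
Proof.
move=> sP cK PK; have [f fI] := sublinear_linear (infconv_sublinear sP cK PK).
exists f; split=> [x|x t Kx]; first exact: le_trans (infconv_le_self sP cK PK x).
have := le_trans (fI (- x)) (infconv_oppr sP PK Kx).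
by rewrite raddfN lerN2.
Qed.

End MazurOrlicz.

(** * Conjugate exponents *)
Section LpNorm2.
Context {R : realType}.
Implicit Types (p q : \bar R) (a b c d : R).

Definition conjugate p q := (1 <= p)%E /\ q = hoelder_conjugate p.

Lemma conjugate_sym p q : conjugate p q -> conjugate q p.
Proof.
by case=> p1 ->; split; [exact: hoelder_conj_ge1 | rewrite hoelder_conjugateK].
Qed.

Variant conjugate_spec : \bar R -> \bar R -> Prop :=
| Conjugate1y : conjugate_spec 1%E +oo%E
| Conjugatey1 : conjugate_spec +oo%E 1%E
| ConjugateFin (r s : R) of 1 < r & 1 < s & r^-1 + s^-1 = 1 :
    conjugate_spec r%:E s%:E.

Lemma conjugateP p q : conjugate p q -> conjugate_spec p q.
Proof.
case=> + ->; case: p => [r| |] //= r1; last first.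
  by rewrite hoelder_conjugatey; exact: Conjugatey1.
move: r1; rewrite lee_fin le_eqVlt => /predU1P[<-|r1].
  by rewrite hoelder_conjugate1; exact: Conjugate1y.
have r0 : 0 < r by lra.
have rB : 0 < r - 1 by lra.
rewrite /hoelder_conjugate/= eqe gt_eqF// -EFinD inver gt_eqF// -EFinM.
apply: ConjugateFin => //; first by rewrite ltr_pdivlMr// mul1r; lra.
by field; rewrite !gt_eqF.
Qed.

Lemma lpnorm2_1 a b : 0 <= a -> 0 <= b -> lpnorm2 1%E a b = a + b.
Proof. by move=> a0 b0; rewrite /= invr1 !powRr1// addr_ge0. Qed.

Lemma lpnorm2C p a b : lpnorm2 p a b = lpnorm2 p b a.
Proof. by case: p => [r| |] /=; [rewrite addrC|rewrite maxC|]. Qed.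

Lemma lpnorm2_ge0 p a b : 0 <= a -> 0 <= lpnorm2 p a b.
Proof.
by move=> a0; case: p => [r| |]//=; rewrite ?powR_ge0// le_max a0.
Qed.

Lemma lpnorm2_hoelder p q a b c d : conjugate p q ->
  0 <= a -> 0 <= b -> 0 <= c -> 0 <= d ->
  a * c + b * d <= lpnorm2 p a b * lpnorm2 q c d.
Proof.
move=> + a0 b0 c0 d0; case/conjugateP => [||r s r1 s1 rs].
- rewrite lpnorm2_1//= mulrDl lerD// ler_wpM2l// le_max lexx ?orbT//.
- rewrite lpnorm2_1//= mulrDr lerD// ler_wpM2r// le_max lexx ?orbT//.
- by apply: hoelder2 => //; lra.
Qed.

(** Equality is attained in Hölder's inequality. This makes [lpnorm2 p] a supremum of linear forms
    with nonnegative coefficients, from which monotonicity, subadditivity and homogeneity follow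
    uniformly in [p]. *)
Lemma lpnorm2_dual p q a b : conjugate p q -> 0 <= a -> 0 <= b ->
  exists c d, [/\ 0 <= c, 0 <= d, lpnorm2 q c d <= 1 &
                  lpnorm2 p a b <= a * c + b * d].
Proof.
move=> + a0 b0; case/conjugateP => [||r s r1 s1 rs].
- by exists 1, 1; split; rewrite ?lpnorm2_1//= ?maxxx ?mulr1 ?lexx.
- have [ab|ba] := leP a b.
    by exists 0, 1; split; rewrite ?lpnorm2_1//= ?max_r// ?mulr0 ?mulr1
      ?add0r ?lexx.
  have {}ba := ltW ba.
  by exists 1, 0; split; rewrite ?lpnorm2_1//= ?max_l// ?mulr0 ?mulr1
    ?addr0 ?lexx.
set N := lpnorm2 r%:E a b.
have : 0 <= N := lpnorm2_ge0 _ _ a0.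
rewrite le_eqVlt => /predU1P[<-|N0].
  exists 0, 0; split=> //=; last by rewrite !mulr0 addr0.
  by rewrite !powR0 ?invr_eq0 ?addr0 ?powR0 ?invr_eq0 ?gt_eqF//; lra.
have r0 : 0 < r by lra.
have Nr : N `^ r = a `^ r + b `^ r.
  by rewrite /N/= -powRrM mulVf ?gt_eqF// powRr1// addr_ge0// powR_ge0.
have rs' : (r - 1) * s = r.
  have s0 : 0 < s by lra.
  have : (r^-1 + s^-1) * (r * s) = r * s by rewrite rs mul1r.
  have -> : (r^-1 + s^-1) * (r * s) = s + r by field; rewrite !gt_eqF.
  lra.
have E x : 0 <= x -> x * (x / N) `^ (r - 1) = x `^ r / N `^ (r - 1).
  move=> x0; rewrite powRM// ?invr_ge0 ?(ltW N0)// mulrA mulr_powRB1//.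
  by rewrite -powR_inv1 ?(ltW N0)// -powRrM mulN1r powRN.
have F x : 0 <= x -> ((x / N) `^ (r - 1)) `^ s = x `^ r / N `^ r.
  move=> x0; rewrite -powRrM rs' powRM// ?invr_ge0 ?(ltW N0)//.
  by rewrite -powR_inv1 ?(ltW N0)// -powRrM mulN1r powRN.
(* The Hölder extremal; its [s]-norm is 1 because [(r - 1) * s = r]. *)
exists ((a / N) `^ (r - 1)), ((b / N) `^ (r - 1)); split; rewrite ?powR_ge0//.
  by rewrite /= !F// -mulrDl -Nr divff ?powR1// gt_eqF// powR_gt0.
rewrite !E// -mulrDl -Nr -(mulr_powRB1 (ltW N0) r0) mulfK//.
by rewrite gt_eqF// powR_gt0.
Qed.

Lemma le_lpnorm2 p q a b a' b' : conjugate p q ->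
  0 <= a <= a' -> 0 <= b <= b' -> lpnorm2 p a b <= lpnorm2 p a' b'.
Proof.
move=> pq /andP[a0 aa'] /andP[b0 bb'].
have [a'0 b'0] := (le_trans a0 aa', le_trans b0 bb').
have [c [d [c0 d0 cd1 /le_trans->]]] := lpnorm2_dual pq a0 b0; first by [].
have := lpnorm2_hoelder pq a'0 b'0 c0 d0.
have := ler_wpM2l (lpnorm2_ge0 p b' a'0) cd1; rewrite mulr1.
have := ler_wpM2r c0 aa'; have := ler_wpM2r d0 bb'; lra.
Qed.

Lemma ler_lpnorm2D p q a b a' b' : conjugate p q ->
  0 <= a -> 0 <= b -> 0 <= a' -> 0 <= b' ->
  lpnorm2 p (a + a') (b + b') <= lpnorm2 p a b + lpnorm2 p a' b'.
Proof.
move=> pq a0 b0 a'0 b'0.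
have [c [d [c0 d0 cd1 /le_trans->]]] :=
  lpnorm2_dual pq (addr_ge0 a0 a'0) (addr_ge0 b0 b'0); first by [].
have := lpnorm2_hoelder pq a0 b0 c0 d0.
have := lpnorm2_hoelder pq a'0 b'0 c0 d0.
have := ler_wpM2l (lpnorm2_ge0 p b a0) cd1.
have := ler_wpM2l (lpnorm2_ge0 p b' a'0) cd1.
lra.
Qed.

Lemma ler_lpnorm2Z p q (t : R) a b : conjugate p q ->
  0 <= t -> 0 <= a -> 0 <= b ->
  lpnorm2 p (t * a) (t * b) <= t * lpnorm2 p a b.
Proof.
move=> pq t0 a0 b0.
have [c [d [c0 d0 cd1 /le_trans->]]] :=
  lpnorm2_dual pq (mulr_ge0 t0 a0) (mulr_ge0 t0 b0); first by [].
have := ler_wpM2l t0 (lpnorm2_hoelder pq a0 b0 c0 d0).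
have := ler_wpM2l t0 (ler_wpM2l (lpnorm2_ge0 p b a0) cd1).
rewrite mulr1; lra.
Qed.

Lemma lpnorm2_ge_l p q a b : conjugate p q -> 0 <= a -> 0 <= b ->
  a <= lpnorm2 p a b.
Proof.
move=> pq a0 b0; have := lpnorm2_hoelder pq a0 b0 ler01 (lexx 0).
rewrite mulr1 mulr0 addr0 => /le_trans; apply.
rewrite ler_piMr ?lpnorm2_ge0//.
case/conjugateP: pq => [||r s r1 s1 rs].
- by rewrite /= max_l.
- by rewrite lpnorm2_1// addr0.
by rewrite /= powR1 powR0 ?addr0 ?powR1// gt_eqF//; lra.
Qed.

End LpNorm2.

(** * Dual spaces and dual cones *)
Section DualBasics.
Context {R : realType} {E : normedModType R}.
Implicit Types (f g : dual E) (C : set E).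

Lemma dual_normE f : `|f| = opnorm f. Proof. by []. Qed.

Lemma dual_addE f g x : (f + g) x = f x + g x. Proof. by []. Qed.

Lemma dual_oppE f x : (- f) x = - f x. Proof. by []. Qed.

Lemma dual_subE f g x : (f - g) x = f x - g x. Proof. by []. Qed.

Lemma dual_scaleE (a : R) f x : (a *: f) x = a * f x. Proof. by []. Qed.

Lemma ler_norm_dual f x : `|f x| <= `|f| * `|x|.
Proof. exact: opnorm_ub. Qed.

Lemma ler_dual f x : f x <= `|f| * `|x|.
Proof. exact: le_trans (ler_norm _) (ler_norm_dual f x). Qed.

Lemma dual_norm_le_ball f M : (forall x, `|x| <= 1 -> f x <= M) -> `|f| <= M.
Proof.
move=> fM; rewrite dual_normE; apply: ge_sup.
  by exists `|f 0|, 0 => //=; rewrite normr0.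
move=> _ [x /= x1 <-]; rewrite ler_norml fM// andbT lerNl.
by have := fM (- x); rewrite normrN raddfN => /(_ x1).
Qed.

Lemma dual_norm_le f M : 0 <= M -> (forall x, f x <= M * `|x|) -> `|f| <= M.
Proof.
move=> M0 fM; apply: dual_norm_le_ball => x x1.
by apply: le_trans (fM x) _; rewrite ler_piMr.
Qed.

Lemma dual_eqP f g : (forall x, f x = g x) -> f = g.
Proof. by move=> fg; apply/val_inj/funext. Qed.

Lemma linear_bounded_dual (f : {linear E -> R^o}) M : 0 <= M ->
  (forall x, f x <= M * `|x|) ->
  exists g : dual E, (forall x, g x = f x) /\ `|g| <= M.
Proof.
move=> M0 fM.
have fM' x : `|f x| <= M * `|x|.
  by rewrite ler_norml fM andbT lerNl -raddfN -normrN fM.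
have fc : (f : E -> R^o) \in contlin E.
  rewrite inE; split; first by move=> a x y; rewrite linearP.
  apply: bounded_linear_continuous; apply/linear_boundedP.
  exists M; split=> [|r Mr x]; first exact: num_real.
  by apply: le_trans (fM' x) _; rewrite ler_wpM2r// ltW.
exists (Dual fc); split => //.
exact: dual_norm_le.
Qed.

Lemma norm_sublinear M : 0 <= M -> sublinear (fun x : E => M * `|x|).
Proof.
move=> M0; split=> [x y|a x a0]; first by rewrite -mulrDr ler_wpM2l// ler_normD.
by rewrite normrZ (ger0_norm a0) mulrCA.
Qed.

Lemma exists_norming x : exists f, `|f| <= 1 /\ `|x| <= f x.
Proof.
have [|f [fN fK]] := mazur_orlicz (norm_sublinear ler01)
  (ray_epicone x `|x|).
  by move=> y t [a a0 [-> ->]]; rewrite normrZ mul1r ger0_norm.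
have [g [gf g1]] := linear_bounded_dual ler01 fN.
by exists g; split=> //; rewrite gf; apply: fK; exists 1; rewrite // scale1r mul1r.
Qed.

Lemma coneD C x y : cone C -> C x -> C y -> C (x + y).
Proof. by move=> cC Cx Cy; rewrite -[x]scale1r; apply: cC. Qed.

Lemma coneZ C (a : R) x : cone C -> C 0 -> 0 <= a -> C x -> C (a *: x).
Proof. by move=> cC C0 a0 Cx; rewrite -[_ *: _]addr0; apply: cC. Qed.

Lemma dual_cone_cone C : cone (dual_cone C).
Proof.
move=> a f g a0 Cf Cg x Cx.
by rewrite dual_addE dual_scaleE addr_ge0 ?mulr_ge0 ?Cf ?Cg.
Qed.

Lemma dual_cone0 C : dual_cone C 0.
Proof. by move=> x _. Qed.

Lemma dual_cone_separation C x : cone C -> C 0 -> closed C -> ~ C x ->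
  exists2 f, dual_cone C f & f x < 0.
Proof.
move=> cC C0 clC nCx.
have [d d0 dC] : exists2 d, 0 < d & forall c, C c -> d <= `|c - x|.
  have /nbhs_normP[d /= d0 dC] : nbhs x (~` C).
    by apply: open_nbhs_nbhs; split=> //; exact: closed_openC.
  exists d => // c Cc; rewrite leNgt; apply/negP => cd.
  by apply: (dC c) => //=; rewrite distrC.
(* The constraints are [0 <= f c] on [C] and [d <= f (- x)]. They are compatible with the norm since
   [s^-1 *: c] stays in [C], hence at distance at least [d] from [x]. *)
pose K y t := exists s c, [/\ 0 <= s, C c, y = c - s *: x & t = s * d].
have cK : epicone K.
  split; first by exists 0, 0; rewrite scale0r mul0r subrr.
    move=> _ _ _ _ [s [c [s0 Cc -> ->]]] [s' [c' [s'0 Cc' -> ->]]].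
    exists (s + s'), (c + c'); rewrite addr_ge0// mulrDl; split=> //.
      exact: coneD.
    by rewrite scalerDl opprD addrACA.
  move=> a _ _ a0 [s [c [s0 Cc -> ->]]]; exists (a * s), (a *: c).
  rewrite mulr_ge0// mulrA; split=> //; first exact: coneZ.
  by rewrite scalerBr scalerA.
have [|f [fN fK]] := mazur_orlicz (norm_sublinear ler01) cK.
  move=> _ _ [s [c [+ Cc -> ->]]]; rewrite mul1r.
  rewrite le_eqVlt => /predU1P[<-|s0]; first by rewrite mul0r.
  have s'0 : 0 < s^-1 by rewrite invr_gt0.
  have h := dC _ (coneZ cC C0 (ltW s'0) Cc).
  rewrite -(ler_pM2l s'0) mulKf ?gt_eqF//.
  apply: (le_trans h); rewrite -[X in X * _](@ger0_norm _ s^-1) ?(ltW s'0)//.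
  by rewrite -normrZ scalerBr scalerA mulVf ?gt_eqF// scale1r.
have [g [gf _]] := linear_bounded_dual ler01 fN.
exists g => [c Cc|]; rewrite gf.
  by apply: fK; exists 0, c; rewrite mul0r scale0r subr0.
rewrite -oppr_gt0 -raddfN; apply: lt_le_trans d0 _.
by apply: fK; exists 1, 0; rewrite sub0r scale1r mul1r.
Qed.

Lemma dual_cone_closed C : closed (dual_cone C).
Proof.
move=> f clf x Cx; rewrite leNgt; apply/negP => fx.
have e0 : 0 < - f x / (`|x| + 1) by rewrite divr_gt0 ?oppr_gt0// ltr_wpDl.
have [g [Cg]] := clf _ (nbhsx_ballx f _ e0).
rewrite -ball_normE /= => fg.
have := ler_dual (g - f) x; have := Cg _ Cx.
have h : `|g - f| * (`|x| + 1) < - f x.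
  by rewrite -ltr_pdivlMr ?ltr_wpDl// distrC.
have := normr_ge0 (g - f).
rewrite dual_subE; rewrite mulrDr mulr1 in h; lra.
Qed.

End DualBasics.

(** * The dual norm of an l^p sum of two copies of a space *)

Section DualPair.
Context {R : realType} {E : normedModType R}.
Variables (p q : \bar R) (pq : conjugate p q).

Lemma lpnorm2_sublinear M : 0 <= M ->
  sublinear (fun w : E * E => M * lpnorm2 p `|w.1| `|w.2|).
Proof.
move=> M0; split=> [x y|a x a0] /=.
  rewrite -mulrDr ler_wpM2l//.
  apply: le_trans (ler_lpnorm2D pq _ _ _ _) => //.
  by apply: (le_lpnorm2 pq); rewrite normr_ge0 ler_normD.
rewrite mulrCA ler_wpM2l// !normrZ (ger0_norm a0).
exact: (ler_lpnorm2Z pq).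
Qed.

(** Extremal weights [c], [d] turn the l^q norm into [c * |f| + d * |g|]; the two dual norms are
    then tested one after the other on unit vectors scaled by [c] and [d]. *)
Lemma lpnorm2_dual_le (f g : dual E) M : 0 <= M ->
  (forall x y, f x + g y <= M * lpnorm2 p `|x| `|y|) ->
  lpnorm2 q `|f| `|g| <= M.
Proof.
move=> M0 fgM.
have [c [d [c0 d0 cd /le_trans->//]]] :=
  lpnorm2_dual (conjugate_sym pq) (normr_ge0 f) (normr_ge0 g).
rewrite mulrC [X in _ + X]mulrC -lerBrDr.
rewrite -[X in X * _](ger0_norm c0) -normrZ; apply: dual_norm_le_ball => x x1.
rewrite lerBrDr addrC -lerBrDr.
rewrite -[X in X * _](ger0_norm d0) -normrZ; apply: dual_norm_le_ball => y y1.
rewrite lerBrDr addrC !dual_scaleE.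
have := fgM (c *: x) (d *: y); rewrite !linearZ => /le_trans; apply.
rewrite -[leRHS]mulr1 ler_wpM2l//; apply: le_trans cd.
by apply: (le_lpnorm2 pq); rewrite normr_ge0 normrZ ger0_norm ?ler_piMr.
Qed.

End DualPair.

(** * Duality of (O.p.1) and (O.p'.2) *)
Section Duality.
Context {R : realType} {E : normedModType R}.
Variables (p q : \bar R) (pq : conjugate p q).
Variable C : set E.
Hypotheses (cC : cone C) (C0 : C 0).

Let pairD (x y x' y' : E) : (x, y) + (x', y') = (x + x', y + y') :> E * E.
Proof. by []. Qed.

Let pairZ (a : R) (x y : E) : a *: (x, y) = (a *: x, a *: y) :> E * E.
Proof. by []. Qed.

Lemma dominated_pair (phi : {linear (E * E)%type -> R^o}) M : 0 <= M ->
  (forall w, phi w <= M * lpnorm2 p `|w.1| `|w.2|) ->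
  exists f g : dual E, (forall x y, phi (x, y) = f x + g y) /\
    lpnorm2 q `|f| `|g| <= M.
Proof.
move=> M0 phiM.
(* A crude bound that only ensures continuity of the two coordinate functionals; the sharp constant
   comes from [lpnorm2_dual_le]. *)
have bound (w : E * E) : phi w <= M * lpnorm2 p 1 1 * (`|w.1| + `|w.2|).
  apply: le_trans (phiM w) _; rewrite -mulrA ler_wpM2l// mulrC.
  apply: le_trans _ (ler_lpnorm2Z pq (addr_ge0 _ _) _ _) => //.
  rewrite !mulr1; apply: (le_lpnorm2 pq).
    by rewrite normr_ge0 lerDl normr_ge0.
  by rewrite normr_ge0 lerDr normr_ge0.
have phiD x y : phi (x, y) = phi (x, 0) + phi (0, y).
  by rewrite -raddfD pairD addr0 add0r.
have l1 : linear (fun x => phi (x, 0) : R^o).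
  by move=> a x y; rewrite -linearP pairZ pairD scaler0 addr0.
have l2 : linear (fun x => phi (0, x) : R^o).
  by move=> a x y; rewrite -linearP pairZ pairD scaler0 addr0.
pose m1 := GRing.isLinear.Build R E R^o *:%R _ l1.
pose m2 := GRing.isLinear.Build R E R^o *:%R _ l2.
pose f1 : {linear E -> R^o} := HB.pack (fun x => phi (x, 0) : R^o) m1.
pose f2 : {linear E -> R^o} := HB.pack (fun x => phi (0, x) : R^o) m2.
have M1 : 0 <= M * lpnorm2 p 1 1 by rewrite mulr_ge0 ?lpnorm2_ge0.
have [|g1 [g1E _]] := @linear_bounded_dual _ _ f1 _ M1.
  by move=> x; have /= := bound (x, 0); rewrite normr0 addr0.
have [|g2 [g2E _]] := @linear_bounded_dual _ _ f2 _ M1.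
  by move=> x; have /= := bound (0, x); rewrite normr0 add0r.
have E12 x y : phi (x, y) = g1 x + g2 y by rewrite g1E g2E; exact: phiD.
exists g1, g2; split=> //; apply: (lpnorm2_dual_le pq) => // x y.
by rewrite -E12; exact: phiM.
Qed.

(* A positive decomposition [f = f1 - f2] is a functional on [E * E] that is
   nonnegative on [C * C] and restricts to [f] on the antidiagonal. *)
Lemma Op1_dual_OSp2 : Op1 p C -> OSp2 q (dual_cone C).
Proof.
move=> O1 f.
(* Taking [z = 0] encodes positivity of both components; taking [a = b = 0] encodes
   [f z <= f1 z - f2 z], which becomes an equality on replacing [z] by [- z]. *)
pose K (w : E * E) t := exists a b z,
  [/\ C a, C b, w = (a + z, b - z) & t = f z].
have cK : epicone K.
  split; first by exists 0, 0, 0; rewrite (raddf0 f) subr0 addr0.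
    move=> _ _ _ _ [a [b [z [Ca Cb -> ->]]]] [a' [b' [z' [Ca' Cb' -> ->]]]].
    exists (a + a'), (b + b'), (z + z'); rewrite (raddfD f); split=> //.
    - exact: coneD.
    - exact: coneD.
    - by rewrite pairD; congr (_, _); rewrite ?opprD addrACA.
  move=> l _ _ l0 [a [b [z [Ca Cb -> ->]]]].
  exists (l *: a), (l *: b), (l *: z); rewrite (linearZ_LR f); split=> //.
  - exact: coneZ.
  - exact: coneZ.
  - by rewrite pairZ scalerDr scalerBr.
have [|phi [phiM phiK]] :=
  mazur_orlicz (lpnorm2_sublinear pq (normr_ge0 f)) cK.
  (* (O.p.1) is applied to [z - b <= z <= a + z]. *)
  move=> _ _ [a [b [z [Ca Cb -> ->]]]] /=.
  apply: le_trans (ler_dual f z) _; rewrite ler_wpM2l// lpnorm2C distrC.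
  by apply: O1; rewrite /cone_le ?addrK ?subKr// opprB addrC subrK.
have [f1 [f2 [phiE fN]]] := dominated_pair (normr_ge0 f) phiM.
exists f1, f2; split=> //.
- move=> a Ca; have := phiK (a, 0) 0; rewrite phiE raddf0 addr0; apply.
  by exists a, 0, 0; rewrite (raddf0 f) addr0 subr0.
- move=> b Cb; have := phiK (0, b) 0; rewrite phiE raddf0 add0r; apply.
  by exists 0, b, 0; rewrite (raddf0 f) addr0 subr0.
- have le z : f z <= f1 z - f2 z.
    have := phiK (z, - z) (f z); rewrite phiE raddfN; apply.
    by exists 0, 0, z; rewrite add0r sub0r.
  apply: dual_eqP => z; rewrite dual_subE; apply/eqP; rewrite eq_le le/=.
  by have := le (- z); rewrite !raddfN/=; lra.
Qed.

(** For [f <= g <= h] and [x = x1 - x2] with positive parts, [g x <= h x1 - f x2], and Hölder's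
    inequality bounds the right side. *)
Lemma Op2_dual_Op1 : Op2 p C -> Op1 q (dual_cone C).
Proof.
move=> O2 f g h fg gh; apply: dual_norm_le => [|x]; first exact: lpnorm2_ge0.
set N := lpnorm2 _ _ _.
have N0 : 0 <= N by exact: lpnorm2_ge0.
apply/ler_addgt0Pr => e e0.
(* Dividing by [N + 1] keeps the error times [N] below [e] even when [N] is 0. *)
have e1 : 0 < e / (N + 1) by rewrite divr_gt0// ltr_wpDl.
have [x1 [x2 [Cx1 Cx2 xE xN]]] := O2 x _ e1.
have h1 : N * (`|x| + e / (N + 1)) <= N * `|x| + e.
  rewrite mulrDr lerD2l mulrCA ler_piMr ?ltW// ltr_pdivrMr ?ltr_wpDl//.
  by rewrite mul1r ltrDl.
apply: le_trans h1; apply: le_trans (ler_wpM2l N0 (ltW xN)).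
rewrite /N lpnorm2C.
apply: le_trans (lpnorm2_hoelder (conjugate_sym pq) _ _ _ _) => //.
have := ler_dual h x1; have := ler_dual (- f) x2; rewrite normrN.
have := fg _ Cx2; have := gh _ Cx1; rewrite !dual_subE dual_oppE.
rewrite [in X in _ -> _ -> _ -> _ -> X]xE raddfB/=; lra.
Qed.

(** A norming functional of [v] is split as [g1 - g2]; positivity gives
    [g1 v - g2 v <= g1 w - g2 u], and Hölder's inequality concludes. *)
Lemma dual_Op2_Op1 : Op2 q (dual_cone C) -> Op1 p C.
Proof.
move=> O2 u v w uv vw; have [f [f1 fv]] := exists_norming v.
set N := lpnorm2 _ _ _.
have N0 : 0 <= N by exact: lpnorm2_ge0.
apply/ler_addgt0Pr => e e0.
have e1 : 0 < e / (N + 1) by rewrite divr_gt0// ltr_wpDl.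
have [g1 [g2 [Cg1 Cg2 fE fN]]] := O2 f _ e1.
have h1 : N * (1 + e / (N + 1)) <= N + e.
  rewrite mulrDr mulr1 lerD2l mulrCA ler_piMr ?ltW// ltr_pdivrMr ?ltr_wpDl//.
  by rewrite mul1r ltrDl.
apply: le_trans fv _; apply: le_trans h1.
have fN' : lpnorm2 q `|g1| `|g2| <= 1 + e / (N + 1).
  by apply: le_trans (ltW fN) _; rewrite lerD2r.
apply: le_trans (ler_wpM2l N0 fN').
rewrite /N lpnorm2C.
apply: le_trans (lpnorm2_hoelder pq _ _ _ _) => //.
have := ler_dual g1 w; have := ler_dual g2 (- u); rewrite normrN raddfN.
have := Cg1 _ vw; have := Cg2 _ uv; rewrite !raddfB fE dual_subE/=; lra.
Qed.

(* [f] is squeezed between [- g] and [h] with [lpnorm2 q `|h| `|g| <= 1]. *)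
Lemma dominated_on_cone_norm_le (f : dual E) : Op1 q (dual_cone C) ->
  (forall a b, C a -> C b -> f a - f b <= lpnorm2 p `|a| `|b|) -> `|f| <= 1.
Proof.
move=> O1 fC.
pose K (w : E * E) t := [/\ C w.1, C w.2 & t = f w.1 - f w.2].
have cK : epicone K.
  split; first by split; rewrite //= raddf0 subrr.
    move=> x y _ _ [Cx1 Cx2 ->] [Cy1 Cy2 ->]; split.
    - exact: coneD.
    - exact: coneD.
    - by rewrite addrACA -opprD -!(raddfD f).
  move=> a x _ a0 [Cx1 Cx2 ->]; split.
  - exact: coneZ.
  - exact: coneZ.
  - by rewrite mulrBr -!(linearZ_LR f).
have [|phi [phiM phiK]] := mazur_orlicz (lpnorm2_sublinear pq ler01) cK.
  by move=> x _ [Cx1 Cx2 ->]; rewrite mul1r; exact: fC.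
have [h [g [phiE hg]]] := dominated_pair ler01 phiM.
apply: le_trans hg; rewrite lpnorm2C -[X in lpnorm2 _ X]normrN; apply: O1.
  move=> x Cx; rewrite opprK dual_addE.
  have := phiK (0, x) (- f x); rewrite phiE raddf0 add0r.
  rewrite -lerBlDl sub0r; apply; split=> //=; first by rewrite raddf0 sub0r.
move=> x Cx; rewrite dual_subE subr_ge0.
have := phiK (x, 0) (f x); rewrite phiE raddf0 addr0; apply.
by split=> //=; rewrite raddf0 subr0.
Qed.

(** If no such pair existed, some functional [g] would satisfy [r <= g x] and
    [g (a - b) <= lpnorm2 p |a| |b|] on [C]. The latter forces [|g| <= 1], against [|x| < r]. *)
Lemma dual_Op1_approx : Op1 q (dual_cone C) ->
  forall (x : E) (r d : R), `|x| < r -> 0 < d -> exists a b,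
    [/\ C a, C b, lpnorm2 p `|a| `|b| < r & `|x - (a - b)| < d].
Proof.
move=> O1 x r d xr d0; apply: contrapT => nex.
have r0 : 0 < r by exact: le_lt_trans (normr_ge0 x) xr.
(* The penalty factor for which [M * |x - (a - b)| < r] means a distance below [d]. *)
pose M := r / d; have M0 : 0 <= M by rewrite divr_ge0 ?ltW.
have rle a b : C a -> C b -> r <= lpnorm2 p `|a| `|b| + M * `|x - (a - b)|.
  move=> Ca Cb; rewrite leNgt; apply/negP => h; apply: nex; exists a, b.
  have N0 := lpnorm2_ge0 p `|b| (normr_ge0 a).
  split=> //; first by apply: le_lt_trans h; rewrite lerDl mulr_ge0.
  have : M * `|x - (a - b)| < r by apply: le_lt_trans h; rewrite lerDr.
  by rewrite /M mulrAC ltr_pdivrMr// ltr_pM2l.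
(* An inequality for [t], since [lpnorm2] is only subadditive and an equality would not be stable
   under sums. *)
pose K (y : E) (t : R) := exists (s : R) a b,
  [/\ 0 <= s, C a, C b, y = s *: x - (a - b) &
      t <= s * r - lpnorm2 p `|a| `|b|].
have sN := @lpnorm2_sublinear _ E _ _ pq _ ler01.
have ND (a b a' b' : E) : lpnorm2 p `|a + a'| `|b + b'| <=
    lpnorm2 p `|a| `|b| + lpnorm2 p `|a'| `|b'|.
  by have := sN.1 (a, b) (a', b'); rewrite /= !mul1r.
have NZ (l : R) (a b : E) : 0 <= l ->
    lpnorm2 p `|l *: a| `|l *: b| <= l * lpnorm2 p `|a| `|b|.
  by move=> l0; have := sN.2 l (a, b) l0; rewrite /= !mul1r.
have cK : epicone K.
  split; first exists 0, 0, 0.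
      rewrite scale0r !subrr mul0r; split=> //.
      by rewrite sub0r oppr_ge0; have := NZ 0 0 0 (lexx _); rewrite scaler0 mul0r.
    move=> _ _ t t' [s [a [b [s0 Ca Cb -> tE]]]]
      [s' [a' [b' [s'0 Ca' Cb' -> tE']]]].
    exists (s + s'), (a + a'), (b + b').
    rewrite addr_ge0//; split=> //; [exact: coneD|exact: coneD| |].
      by rewrite scalerDl addrACA -opprD; congr (_ - _); rewrite opprD addrACA.
    by have := ND a b a' b'; lra.
  move=> l _ t l0 [s [a [b [s0 Ca Cb -> tE]]]].
  exists (l * s), (l *: a), (l *: b).
  rewrite mulr_ge0//; split=> //; [exact: coneZ|exact: coneZ| |].
    by rewrite scalerBr scalerA scalerBr.
  apply: le_trans (ler_wpM2l l0 tE) _.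
  by rewrite mulrBr mulrA lerB// NZ.
have [|f [fM fK]] := mazur_orlicz (@norm_sublinear _ E _ M0) cK.
  move=> _ t [s [a [b [s0 Ca Cb -> /le_trans tE]]]].
  apply: tE; move: s0; rewrite le_eqVlt => /predU1P[<-|s0].
    rewrite mul0r sub0r; apply: (@le_trans _ _ 0); last exact: mulr_ge0.
    by rewrite oppr_le0 lpnorm2_ge0.
  have s'0 : 0 < s^-1 by rewrite invr_gt0.
  rewrite lerBlDl -(ler_pM2l s'0) mulKf ?gt_eqF// mulrDr.
  have h := rle _ _ (coneZ cC C0 (ltW s'0) Ca) (coneZ cC C0 (ltW s'0) Cb).
  apply: le_trans h _; apply: lerD.
    exact: NZ (ltW s'0).
  rewrite mulrCA ler_wpM2l// -[X in X * _](ger0_norm (ltW s'0)) -normrZ.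
  by rewrite scalerBr scalerA mulVf ?gt_eqF// scale1r scalerBr.
have [g [gf _]] := linear_bounded_dual M0 fM.
have g1 : `|g| <= 1.
  apply: dominated_on_cone_norm_le => // a b Ca Cb.
  have := fK (- (a - b)) (- lpnorm2 p `|a| `|b|).
  rewrite (raddfN f) lerN2/= -gf (raddfB g)/=; apply.
  by exists 0, a, b; rewrite scale0r mul0r !sub0r lexx.
have : r <= g x.
  rewrite gf; apply: fK; exists 1, 0, 0; rewrite ler01 scale1r !subr0.
  split=> //; rewrite mul1r lerDl oppr_ge0.
  by have := NZ 0 0 0 (lexx _); rewrite scaler0 mul0r.
have := ler_dual g x; have := ler_wpM2r (normr_ge0 x) g1; lra.
Qed.

End Duality.

(** * Completeness along geometric sequences *)
Section GeometricSequences.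
Context {R : realType}.

(** Completeness as a predicate, so that it can be passed on to duals, closed subspaces and
    quotients, which carry only a normed module structure here. *)
Definition geo_complete (E : normedModType R) := forall (s : nat -> E) (c : R),
  (forall n, `|s n.+1 - s n| <= c / 2 ^+ n) -> exists l : E, s @ \oo --> l.

Lemma geo_small (c e : R) : 0 < e -> exists n, c / 2 ^+ n < e.
Proof.
move=> e0; have [c0|c0] := leP c 0.
  by exists 0%N; rewrite expr0 divr1; exact: le_lt_trans e0.
have ec0 : 0 < e / c by rewrite divr_gt0.
have [n _ /(_ n (leqnn n))/=] := near_infty_natSinv_expn_lt (PosNum ec0).
by rewrite div1r ltr_pdivlMr// mulrC => h; exists n.
Qed.

Variable E : normedModType R.
Implicit Types (s : nat -> E) (l : E).

Lemma geo_cvg s l (c : R) : (forall n, `|l - s n| <= c / 2 ^+ n) ->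
  s @ \oo --> l.
Proof.
move=> sl; apply/cvgrPdist_lt => e e0; have [n cn] := geo_small c e0.
have c0 : 0 <= c.
  by have := le_trans (normr_ge0 _) (sl 0%N); rewrite expr0 divr1.
exists n => // m /= nm; apply: le_lt_trans (sl m) _; apply: le_lt_trans cn.
rewrite ler_wpM2l// lef_pV2 ?posrE ?exprn_gt0//.
by rewrite ler_weXn2l// ler1n.
Qed.

Lemma geo_dist s (c : R) n m : (forall k, `|s k.+1 - s k| <= c / 2 ^+ k) ->
  (n <= m)%N -> `|s m - s n| <= c * 2 / 2 ^+ n.
Proof.
move=> sc /subnKC <-; set k := (m - n)%N.
have c0 : 0 <= c.
  by have := le_trans (normr_ge0 _) (sc 0%N); rewrite expr0 divr1.
(* The tail of the geometric series is subtracted so that the bound is stable under induction on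
   [k]. *)
suff : `|s (n + k)%N - s n| <= c * 2 / 2 ^+ n - c * 2 / 2 ^+ (n + k).
  move=> /le_trans; apply; rewrite gerBl.
  by rewrite divr_ge0 ?exprn_ge0// mulr_ge0.
elim: k => [|k IH]; first by rewrite addn0 !subrr normr0.
rewrite addnS.
have -> : s (n + k).+1 - s n = (s (n + k).+1 - s (n + k)%N) + (s (n + k)%N - s n).
  by rewrite addrA subrK.
apply: le_trans (ler_normD _ _) _; apply: le_trans (lerD (sc _) IH) _.
rewrite exprS; have : 2 ^+ (n + k) != 0 :> R by rewrite expf_neq0.
set a := 2 ^+ n; set b := 2 ^+ (n + k) => b0.
have -> : c * 2 / (2 * b) = c / b by field.
have -> : c * 2 / b = c / b + c / b by field.
lra.
Qed.

Lemma geo_lim_dist s l (c : R) n :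
  (forall k, `|s k.+1 - s k| <= c / 2 ^+ k) -> s @ \oo --> l ->
  `|l - s n| <= c * 2 / 2 ^+ n.
Proof.
move=> sc /cvgrPdist_lt sl; apply/ler_addgt0Pr => e /sl[N _ Ns].
have -> : l - s n = (l - s (maxn N n)) + (s (maxn N n) - s n).
  by rewrite addrA subrK.
apply: le_trans (ler_normD _ _) _; rewrite addrC lerD//.
  by apply: geo_dist => //; exact: leq_maxr.
by apply/ltW/Ns; exact: leq_maxl.
Qed.

End GeometricSequences.

Section GeoCompleteness.
Context {R : realType}.

Lemma complete_geo_complete (E : completeNormedModType R) : geo_complete E.
Proof.
move=> s c sc; suff : cvg (s @ \oo) by move/cvg_ex.
apply: cauchy_cvg; apply: cauchy_exP => e e0.
have [n cn] := geo_small (c * 2) e0; exists (s n); exists n => // m /= nm.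
rewrite -ball_normE /ball_ /= distrC; apply: le_lt_trans cn.
exact: geo_dist.
Qed.

(** The pointwise limits form a linear functional, and the geometric tail bound is uniform on the
    unit ball, so the convergence holds in norm. *)
Lemma dual_geo_complete (E : normedModType R) : geo_complete (dual E).
Proof.
move=> s c sc.
have sx (x : E) n : `|(s n.+1 x : R^o) - s n x| <= c * `|x| / 2 ^+ n.
  rewrite -dual_subE; apply: le_trans (ler_norm_dual _ _) _.
  by rewrite mulrAC ler_wpM2r.
have lim_ex (x : E) : exists l : R^o, (fun n => s n x : R^o) @ \oo --> l.
  exact: (@complete_geo_complete R^o _ _ (sx x)).
pose l x : R^o := sval (cid (lim_ex x)).
have sl x : (fun n => s n x : R^o) @ \oo --> l x := svalP (cid (lim_ex x)).
have ll : linear l.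
  move=> a x y; apply: (cvg_unique (@norm_hausdorff _ R^o) (sl _)).
  rewrite /= (_ : (fun n => _) = (fun n => a *: (s n x : R^o) + s n y)).
    by apply: (@cvgD _ R^o); [apply: (@cvgZl_tmp _ R^o)|]; exact: sl.
  by apply/funext => n; rewrite linearP.
pose lm := GRing.isLinear.Build R E R^o *:%R _ ll.
pose f : {linear E -> R^o} := HB.pack l lm.
have fs x n : `|f x - s n x| <= c * 2 / 2 ^+ n * `|x|.
  apply: le_trans (geo_lim_dist n (sx x) (sl x)) _.
  by rewrite [c * _ * 2]mulrAC [leLHS]mulrAC.
have c0 : 0 <= c.
  by have := le_trans (normr_ge0 _) (sc 0%N); rewrite expr0 divr1.
have M0 : 0 <= `|s 0%N| + c * 2 by rewrite addr_ge0// mulr_ge0.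
have [|g [gf _]] := linear_bounded_dual (f := f) M0.
  move=> x; rewrite mulrDl.
  have := fs x 0%N; rewrite expr0 divr1 ler_norml => /andP[_ h].
  by have := ler_dual (s 0%N) x; lra.
exists g; apply: (@geo_cvg _ _ _ _ (c * 2)) => n.
apply: dual_norm_le => [|x]; first by rewrite divr_ge0 ?mulr_ge0 ?exprn_ge0.
by rewrite dual_subE gf; exact: le_trans (ler_norm _) (fs x n).
Qed.

Lemma csub_geo_complete (E : normedModType R) (W : closedSubmod E) :
  geo_complete E -> geo_complete (csub W).
Proof.
move=> cE s c sc; have vc n : `|val (s n.+1) - val (s n)| <= c / 2 ^+ n.
  by rewrite -raddfB; exact: sc.
have [l sl] := cE _ _ vc.
have Wl : l \in W.
  apply: (closed_cvg _ (@submod_pred_closed _ _ W) _ _ sl).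
  by apply: nearW => n; exact: (valP (s n)).
exists (CSub Wl); apply: (@geo_cvg _ _ _ _ (c * 2)) => n.
by rewrite csub_normE raddfB; exact: geo_lim_dist vc sl.
Qed.

Lemma quot_lift (E : normedModType R) (W : closedSubmod E) (q : cquot W) (r : R) :
  `|q| < r -> exists2 x, cproj W x = q & `|x| < r.
Proof.
move=> qr; have e0 : 0 < r - `|q| by rewrite subr_gt0.
have hi : has_inf [set `|x| | x in [set x | cproj W x = q]].
  split; first by exists `|repr q|, (repr q) => //=; exact: cproj_repr.
  by exists 0 => _ [x _ <-].
have [_ [x /= xq <-] xr] := inf_adherent e0 hi.
by exists x => //; rewrite -(subrKC `|q| r).
Qed.

Lemma cproj_norm_le (E : normedModType R) (W : closedSubmod E) (x : E) :
  `|cproj W x| <= `|x|.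
Proof.
apply: ge_inf; first by exists 0 => _ [y _ <-].
by exists x.
Qed.

(** The increments are lifted and summed in [E]. The quotient norm is an infimum that need not be
    attained, hence [c + 1] in place of [c]. *)
Lemma cquot_geo_complete (E : normedModType R) (W : closedSubmod E) :
  geo_complete E -> geo_complete (cquot W).
Proof.
move=> cE s c sc.
have lift n : exists x, cproj W x = s n.+1 - s n /\ `|x| <= (c + 1) / 2 ^+ n.
  have h : `|s n.+1 - s n| < (c + 1) / 2 ^+ n.
    apply: le_lt_trans (sc n) _.
    by rewrite ltr_pM2r ?invr_gt0 ?exprn_gt0// ltrDl.
  by have [x xs xn] := quot_lift h; exists x; split=> //; exact: ltW.
have [x_ xP] := choice lift.
pose t := fix t n : E := if n is m.+1 then t m + x_ m else repr (s 0%N).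
have ts n : cproj W (t n) = s n.
  elim: n => [|n IH]; first exact: cproj_repr.
  by rewrite /= raddfD/= IH (xP n).1 addrC subrK.
have tc n : `|t n.+1 - t n| <= (c + 1) / 2 ^+ n.
  by rewrite /= addrC addKr (xP n).2.
have [l tl] := cE _ _ tc.
exists (cproj W l); apply: (@geo_cvg _ _ _ _ ((c + 1) * 2)) => n.
rewrite -ts -raddfB; apply: le_trans (cproj_norm_le _ _) _.
exact: geo_lim_dist tc tl.
Qed.

End GeoCompleteness.

(** * From approximate to exact decompositions *)

Section ApproximationToEquality.
Context {R : realType} {E : normedModType R}.
Variables (p q : \bar R) (pq : conjugate p q).
Variable C : set E.
Hypotheses (cC : cone C) (C0 : C 0) (clC : closed C) (cE : geo_complete E).

(* Successive approximation: the remainder is halved at each step. *)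
Lemma dual_Op1_bounded_decomposition (x : E) (c : R) :
  Op1 q (dual_cone C) -> `|x| < c ->
  exists a b, [/\ C a, C b, x = a - b & `|a| <= c * 2 /\ `|b| <= c * 2].
Proof.
move=> O1 xc.
have c0 : 0 < c by exact: le_lt_trans xc.
(* One decomposition is chosen for each remainder and radius; pairs outside the range of the
   approximation lemma get the dummy value 0. *)
have /choice[step stepP] : forall yr : E * R, exists ab : E * E, `|yr.1| < yr.2 ->
    [/\ C ab.1, C ab.2, lpnorm2 p `|ab.1| `|ab.2| < yr.2 &
        `|yr.1 - (ab.1 - ab.2)| < yr.2 / 2].
  move=> [y r] /=; have [yr|yr] := ltP `|y| r; last by exists 0.
  have r0 : 0 < r / 2 by rewrite divr_gt0//; exact: le_lt_trans yr.
  have [a [b abP]] := dual_Op1_approx pq cC C0 O1 yr r0.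
  by exists (a, b).
pose rem (AB : E * E) := x - (AB.1 - AB.2).
pose AB := fix AB n : E * E :=
  if n is m.+1 then AB m + step (rem (AB m), c / 2 ^+ m) else 0.
have remS n : rem (AB n.+1) = rem (AB n) -
    ((step (rem (AB n), c / 2 ^+ n)).1 - (step (rem (AB n), c / 2 ^+ n)).2).
  rewrite /rem [RHS]/= -[RHS]addrA -opprD; congr (x - _).
  by rewrite /= opprD addrACA.
have inv n : [/\ C (AB n).1, C (AB n).2 & `|rem (AB n)| < c / 2 ^+ n].
  elim: n => [|n [CA CB IH]].
    by rewrite /rem subrr subr0 expr0 divr1.
  have [Ca Cb _ h] := stepP (rem (AB n), c / 2 ^+ n) IH.
  split; [exact: coneD|exact: coneD|].
  by rewrite remS; apply: lt_le_trans h _; rewrite /= exprSr invfM mulrA.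
have stepN n : lpnorm2 p `|(AB n.+1).1 - (AB n).1| `|(AB n.+1).2 - (AB n).2|
    <= c / 2 ^+ n.
  have [_ _ IH] := inv n; have [_ _ h _] := stepP (rem (AB n), c / 2 ^+ n) IH.
  by rewrite /= ![_ + _ - _]addrAC !subrr !add0r ltW.
have cA n : `|(AB n.+1).1 - (AB n).1| <= c / 2 ^+ n.
  exact: le_trans (lpnorm2_ge_l pq _ _) (stepN n).
have cB n : `|(AB n.+1).2 - (AB n).2| <= c / 2 ^+ n.
  by apply: le_trans _ (stepN n); rewrite lpnorm2C (lpnorm2_ge_l pq).
have [a aP] := cE cA; have [b bP] := cE cB.
exists a, b; split.
- by apply: (closed_cvg _ clC _ _ aP); apply: nearW => n; case: (inv n).
- by apply: (closed_cvg _ clC _ _ bP); apply: nearW => n; case: (inv n).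
- apply: (cvg_unique (@norm_hausdorff _ E) _ (cvgB aP bP)).
  by apply: (@geo_cvg _ _ _ _ c) => n; case: (inv n) => _ _ /ltW.
- split.
    (* The iteration starts at 0, so the distance to its initial term is the norm of the limit. *)
    by have := geo_lim_dist 0 cA aP; rewrite subr0 expr0 divr1.
  by have := geo_lim_dist 0 cB bP; rewrite subr0 expr0 divr1.
Qed.

(** A nearly optimal approximate decomposition of [v] is corrected by an exact decomposition of the
    small remainder, whose cost may be far from optimal. *)
Lemma dual_Op1_Op2 : Op1 q (dual_cone C) -> Op2 p C.
Proof.
move=> O1 v e e0; pose K : R := lpnorm2 p 1 1.
have K0 : 0 <= K by exact: lpnorm2_ge0.
(* The correction has both parts of norm at most [c * 2], so it costs at most
   [c * 2 * K <= e / 2]. *)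
pose c := e / (4 * (K + 1)).
have c0 : 0 < c by rewrite divr_gt0// mulr_gt0// ltr_wpDl.
have ve : `|v| < `|v| + e / 2 by rewrite ltrDl divr_gt0.
have [a [b [Ca Cb abN abv]]] := dual_Op1_approx pq cC C0 O1 ve c0.
have [a' [b' [Ca' Cb' vE [a'c b'c]]]] := dual_Op1_bounded_decomposition O1 abv.
exists (a + a'), (b + b'); split; [exact: coneD|exact: coneD| |].
  by rewrite opprD addrACA -vE addrC subrK.
have h1 : lpnorm2 p `|a + a'| `|b + b'| <=
    lpnorm2 p `|a| `|b| + lpnorm2 p `|a'| `|b'|.
  apply: le_trans (ler_lpnorm2D pq _ _ _ _) => //.
  by apply: (le_lpnorm2 pq); rewrite normr_ge0 ler_normD.
have h2 : lpnorm2 p `|a'| `|b'| <= c * 2 * K.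
  apply: le_trans _ (ler_lpnorm2Z pq _ _ _); rewrite ?mulr1//.
    by apply: (le_lpnorm2 pq); rewrite normr_ge0.
  by rewrite mulr_ge0 ?ltW.
have h3 : c * 2 * K <= e / 2.
  have : c * (K + 1) = e / 4 by rewrite /c; field; rewrite gt_eqF// ltr_wpDl.
  lra.
lra.
Qed.

End ApproximationToEquality.

(** * Weak* closures of quotient cones *)
Section WeakStarClosure.
Context {R : realType}.

(** Evaluations are weak* continuous, which gives one direction. Conversely, the approximants of [g]
    on finite sets generate a filter that contains [A] and converges to [g] pointwise, hence
    weak*. *)
Lemma weak_star_closureP (F : normedModType R) (A : set (dual F)) (g : dual F) :
  weak_star_closure A g <->
  forall (s : seq F) (e : R), 0 < e ->
    exists2 f, A f & forall x, x \in s -> `|f x - g x| < e.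
Proof.
split=> [clg s e e0|app].
  have ev x : continuous (fun f : weak_star F => dual_val f x : R^o).
    move=> f; apply: (@continuous_comp (weak_star F) {ptws F -> R^o} R^o
      (dual_val : dual F -> {ptws F -> R^o}) (@proj F (fun=> R^o) x)).
      exact: initial_continuous.
    exact: (@proj_continuous F (fun=> R^o) x).
  have nb : nbhs (g : weak_star F)
      [set f : dual F | forall x, x \in s -> `|f x - g x| < e].
    elim: s => [|y s IH]; first by apply: filterS filterT => f _ x; rewrite inE.
    have yb : nbhs (g : weak_star F) [set f : dual F | `|f y - g y| < e].
      have /cvgrPdist_lt/(_ e e0) := ev y g.
      by apply: filterS => f; rewrite distrC.
    apply: filterS (filterI yb IH) => f [fy fs] x.
    by rewrite inE => /predU1P[->//|/fs].
  by have [f [Af fs]] := clg _ nb; exists f.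
pose D : set (seq F * R) := [set se | 0 < se.2].
pose B (se : seq F * R) : set (dual F) :=
  A `&` [set f | forall x, x \in se.1 -> `|f x - g x| < se.2].
pose G := filter_from D B.
have FG : ProperFilter G.
  apply: filter_from_proper => [|[s e] e0].
    apply: filter_from_filter; first by exists ([::], 1); rewrite /D/=.
    move=> [s e] [s' e'] e0 e'0; exists (s ++ s', Num.min e e').
      by rewrite /D /= lt_min e0.
    move=> f [Af fs]; split; split=> // x xs.
      by have := fs x; rewrite mem_cat xs lt_min => /(_ isT)/andP[].
    by have := fs x; rewrite mem_cat xs orbT lt_min => /(_ isT)/andP[].
  by have [f Af fs] := app s e e0; exists f.
have Gx x : (fun f : dual F => f x : R^o) @ G --> (g x : R^o).
  apply/cvgrPdist_lt => e e0; exists ([:: x], e) => // f [_ /(_ x)].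
  by rewrite inE eqxx distrC; apply.
have Gg : (dual_val : dual F -> {ptws F -> R^o}) @ G -->
    (dual_val g : {ptws F -> R^o}).
  apply/cvg_sup => x U [_ [[V oV <-] Vg] VU].
  have : nbhs (g x : R^o) V by exact: open_nbhs_nbhs.
  move=> /Gx GV; suff : G [set f : dual F | U f] by [].
  by apply: (@filterS _ G _ [set f : dual F | V (f x)]) GV => f; exact: VU.
have Ggw : G --> (g : weak_star F).
  move=> U [_ [[V oV <-] Vg] VU].
  have : nbhs (dual_val g : {ptws F -> R^o}) V by exact: open_nbhs_nbhs.
  move=> /Gg GV; suff : G U by [].
  by apply: (@filterS _ G _ [set f : dual F | V f]) GV => f; exact: VU.
move=> U /Ggw GU; have GA : G A by exists ([::], 1) => [|f []//]; exact: ltr01.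
by have [f [Af Uf]] := filter_ex (filterI GA GU); exists f.
Qed.

(* A positive functional on [W] that cannot be approximated on [s] is separated
   from the restrictions of [dual_cone C] by some [w] in the span of [s]; by
   [dual_cone_separation], [w] lies in [C], a contradiction. *)
Lemma weak_star_closure_dual_cone (E : normedModType R) (W : closedSubmod E)
    (C : set E) (g : dual (csub W)) : cone C -> C 0 -> closed C ->
  weak_star_closure [set dual_restrict W f | f in dual_cone C] g <->
  dual_cone (csub_cone W C) g.
Proof.
move=> cC C0 clC; split=> [/weak_star_closureP clg x Cx|gC].
  rewrite leNgt; apply/negP => gx.
  have gx' : 0 < - g x by rewrite oppr_gt0.
  have [_ [f Cf <-] /(_ x)] := clg [:: x] _ gx'; rewrite inE eqxx => /(_ isT).
  have : 0 <= dual_restrict W f x by exact: Cf.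
  by rewrite ltr_norml => + /andP[_]; lra.
apply/weak_star_closureP => s e e0; apply: contrapT => nex.
pose x_ (i : 'I_(size s)) := nth 0 s i.
pose ev (h : csub W -> R) : 'rV[R]_(size s) := \row_i h (x_ i).
pose P (v : 'rV[R]_(size s)) : R := \sum_i `|v 0 i|.
have sP : sublinear P.
  split=> [v w|a v a0].
    by rewrite -big_split ler_sum// => i _; rewrite mxE ler_normD.
  by rewrite mulr_sumr ler_sum// => i _; rewrite mxE normrM ger0_norm.
(* The functional sought on the values along [s] is nonnegative on restrictions of positive
   functionals and at least [e] at [- ev g]. *)
pose K v t := exists (f : dual E) a, [/\ 0 <= a, dual_cone C f,
  v = ev (fun x => f (val x) - a * g x) & t = a * e].
have cK : epicone K.
  split.
    exists 0, 0; split=> //; last by rewrite mul0r.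
    by apply/rowP => i; rewrite !mxE mul0r subr0.
    move=> _ _ _ _ [f [a [a0 Cf -> ->]]] [f' [a' [a'0 Cf' -> ->]]].
    exists (f + f'), (a + a'); split.
    - exact: addr_ge0.
    - exact: coneD (@dual_cone_cone _ _ C) Cf Cf'.
    - by apply/rowP => i; rewrite !mxE dual_addE; ring.
    - by rewrite mulrDl.
  move=> l _ _ l0 [f [a [a0 Cf -> ->]]]; exists (l *: f), (l * a); split.
  - exact: mulr_ge0.
  - exact: coneZ (@dual_cone_cone _ _ C) (@dual_cone0 _ _ C) l0 Cf.
  - by apply/rowP => i; rewrite !mxE dual_scaleE; ring.
  - by rewrite mulrA.
have [|phi [_ phiK]] := mazur_orlicz sP cK.
  move=> _ _ [f [a [+ Cf -> ->]]].
  rewrite le_eqVlt => /predU1P[<-|a0]; first by rewrite mul0r sumr_ge0.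
  (* If domination failed, [a^-1 *: f] would approximate [g] within [e] on [s]. *)
  apply: contrapT => /negP; rewrite -ltNge => h; apply: nex.
  exists (dual_restrict W (a^-1 *: f)).
    exists (a^-1 *: f) => //.
    apply: coneZ (@dual_cone_cone _ _ C) (@dual_cone0 _ _ C) _ Cf.
    by rewrite invr_ge0 ltW.
  move=> x /(nthP 0)[i si <-].
  rewrite [X in X - _](_ : _ = a^-1 * f (val (nth 0 s i)))//.
  rewrite -(ltr_pM2l a0); apply: le_lt_trans h.
  rewrite /P (bigD1 (Ordinal si))//= mxE /x_/= -[X in X <= _]addr0 lerD ?sumr_ge0//.
  rewrite -[X in X * _](gtr0_norm a0) -normrM mulrBr.
  by rewrite mulrA divff ?gt_eqF// mul1r.
(* A functional on the finite row of values is evaluation at a combination of the points of [s]. *)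
pose w : csub W := \sum_i phi (delta_mx 0 i) *: x_ i.
have phiE (h : csub W -> R) (lh : linear (h : csub W -> R^o)) : phi (ev h) = h w.
  pose lm := GRing.isLinear.Build R _ R^o *:%R _ lh.
  pose h' : {linear csub W -> R^o} := HB.pack (h : csub W -> R^o) lm.
  rewrite [ev h]row_sum_delta linear_sum -[h w]/(h' w) linear_sum.
  by apply: eq_bigr => i _; rewrite !linearZ/= mxE; exact: mulrC.
have Cw : C (val w).
  apply: contrapT => /(dual_cone_separation cC C0 clC)[f Cf].
  have : 0 <= phi (ev (fun x => f (val x))).
    apply: phiK; exists f, 0; rewrite mul0r; split=> //.
    by apply/rowP => i; rewrite !mxE mul0r subr0.
  by rewrite phiE; [lra|move=> a x y; rewrite !linearP].
have : e <= phi (- ev g).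
  apply: phiK; exists 0, 1; rewrite mul1r; split=> //.
  by apply/rowP => i; rewrite !mxE mul1r sub0r.
rewrite raddfN/= phiE; last by move=> a x y; rewrite linearP.
by have := gC w Cw; lra.
Qed.

Lemma quot_cone_dual_coneP (E : normedModType R) (W : closedSubmod E)
    (C : set E) : cone C -> C 0 -> closed C ->
  quot_cone W (dual_cone C) =
  @quot_restrict _ _ W @^-1` dual_cone (csub_cone W C).
Proof.
move=> cC C0 clC; apply/seteqP; rewrite /quot_cone image_comp.
have -> : @quot_restrict _ _ W \o cproj (annihilator W) = dual_restrict W.
  by apply/funext => f /=; exact: quot_restrict_cproj.
by split=> q /(weak_star_closure_dual_cone _ cC C0 clC).
Qed.

End WeakStarClosure.

(** * Subspaces and quotients *)
Section OrderSmooth.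
Context {R : realType} {E : normedModType R}.
Variables (p q : \bar R) (pq : conjugate p q).
Implicit Types C D : set E.

(** Decompositions make the cone generating; if [x] and [- x] both lie in [C], then [0 <= x <= 0]
    and (O.p.1) gives [x = 0]. *)
Lemma order_smoothI C : cone C -> C 0 -> closed C -> Op1 p C -> Op2 p C ->
  order_smooth p C.
Proof.
move=> cC C0 clC O1 O2; split=> //; last first.
  apply/seteqP; split=> // v _.
  by have [v1 [v2 [Cv1 Cv2 -> _]]] := O2 v 1 ltr01; exists v1; last exists v2.
apply/seteqP; split=> [x [Cx [y Cy yx]]|_ ->]; last first.
  by split=> //; exists 0; rewrite ?oppr0.
suff : `|x| <= 0 by rewrite normr_le0 => /eqP.
have /le_trans : `|x| <= lpnorm2 p `|0 : E| `|0 : E|.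
  by apply: O1; rewrite /cone_le ?subr0// -yx opprK add0r.
apply; rewrite normr0.
by have := ler_lpnorm2Z pq (lexx 0) (lexx 0) (lexx 0); rewrite !mul0r.
Qed.

Lemma order_smooth0 C : order_smooth p C -> C 0.
Proof.
case=> _ pC _ _ _ _; have : (C `&` -%R @` C) 0 by rewrite pC.
by case.
Qed.

Lemma OSp2_Op2 C : OSp2 p C -> Op2 p C.
Proof.
move=> O2 v e e0; have [v1 [v2 [Cv1 Cv2 vE vN]]] := O2 v.
by exists v1, v2; split=> //; apply: le_lt_trans vN _; rewrite ltrDl.
Qed.

Lemma OSp2_sub C D : C `<=` D -> OSp2 p C -> OSp2 p D.
Proof.
move=> CD O2 v; have [v1 [v2 [/CD Dv1 /CD Dv2 vE vN]]] := O2 v.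
by exists v1, v2.
Qed.

End OrderSmooth.

(** * Transport of the order conditions along isometries *)

Section Isometry.
Context {R : realType} {E F : normedModType R} (T : {linear E -> F}).
Hypothesis TN : forall x, `|T x| = `|x|.
Variables (p : \bar R) (D : set F).

Lemma cone_preimage : cone D -> cone (T @^-1` D).
Proof. by move=> cD l x y l0 Dx Dy; rewrite /preimage/= linearP; exact: cD. Qed.

Lemma isometry_closed_preimage : closed D -> closed (T @^-1` D).
Proof.
apply: closed_comp => x _; move: x.
apply: bounded_linear_continuous; apply/linear_boundedP; exists 1; split=> // r r1 x.
by rewrite TN ler_peMl// ltW.
Qed.

Lemma Op1_preimage : Op1 p D -> Op1 p (T @^-1` D).
Proof.
move=> O1 u v w uv vw; rewrite -!TN; apply: O1.
  by rewrite /cone_le -raddfB.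
by rewrite /cone_le -raddfB.
Qed.

Hypothesis Tsurj : forall y, exists x, T x = y.

Lemma Op1_of_preimage : Op1 p (T @^-1` D) -> Op1 p D.
Proof.
move=> O1 u v w; have [u' <-] := Tsurj u; have [v' <-] := Tsurj v.
have [w' <-] := Tsurj w; rewrite /cone_le -!raddfB !TN => uv vw.
exact: O1.
Qed.

Lemma Op2_of_preimage : Op2 p (T @^-1` D) -> Op2 p D.
Proof.
move=> O2 v e e0; have [v' <-] := Tsurj v.
have [v1 [v2 [Dv1 Dv2 -> vN]]] := O2 v' e e0.
by exists (T v1), (T v2); rewrite -raddfB !TN.
Qed.

Lemma OSp2_preimage : OSp2 p D -> OSp2 p (T @^-1` D).
Proof.
move=> O2 v; have [y1 [y2 [+ + + ]]] := O2 (T v).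
have [x1 <-] := Tsurj y1; have [x2 <-] := Tsurj y2.
rewrite !TN -raddfB => Dx1 Dx2 Tv vN; exists x1, x2; split=> //.
apply/eqP; rewrite -subr_eq0 -normr_eq0 -TN raddfB/= Tv.
by rewrite subrr normr0.
Qed.

End Isometry.

(** * The dual of a subspace as a quotient of the dual *)

Section DualOfSubspace.
Context {R : realType} {E : normedModType R} (W : closedSubmod E).

Lemma hahn_banach_extension (g : dual (csub W)) :
  exists2 f : dual E, dual_restrict W f = g & `|f| <= `|g|.
Proof.
(* The graph of [g]; since it is a linear subspace, the one-sided constraint becomes an equality. *)
pose K x t := exists w : csub W, x = val w /\ t = g w.
have cK : epicone K.
  split; first by exists 0; rewrite !raddf0.
    move=> _ _ _ _ [w [-> ->]] [w' [-> ->]]; exists (w + w').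
    by rewrite !raddfD.
  by move=> a _ _ _ [w [-> ->]]; exists (a *: w); rewrite !linearZ.
have [|phi [phiN phiK]] :=
  mazur_orlicz (@norm_sublinear _ E _ (normr_ge0 g)) cK.
  by move=> _ _ [w [-> ->]]; exact: (ler_dual g w).
have [f [fphi fN]] := linear_bounded_dual (normr_ge0 g) phiN.
have le w : g w <= f (val w) by rewrite fphi; apply: phiK; exists w.
exists f => //; apply: dual_eqP => w /=; apply/eqP; rewrite eq_le le andbT.
by have := le (- w); rewrite !raddfN/= lerN2.
Qed.

Lemma dual_restrict_norm_le (f : dual E) : `|dual_restrict W f| <= `|f|.
Proof. by apply: dual_norm_le => // x; exact: (ler_dual f (val x)). Qed.

Lemma quot_restrict_linear : linear (@quot_restrict _ _ W).
Proof.
move=> a x y; rewrite -[x]cproj_repr -[y]cproj_repr -linearP.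
by rewrite !quot_restrict_cproj; apply: dual_eqP.
Qed.

HB.instance Definition _ := GRing.isLinear.Build R (cquot (annihilator W))
  (dual (csub W)) *:%R (@quot_restrict _ _ W) quot_restrict_linear.

(** Restriction does not increase the norm of any representative, and a norm-preserving extension is
    a representative that attains the bound. *)
Lemma quot_restrict_norm (x : cquot (annihilator W)) : `|quot_restrict x| = `|x|.
Proof.
apply/eqP; rewrite eq_le; apply/andP; split.
  apply/ler_addgt0Pr => e e0.
  have [f <- fx] : exists2 f, cproj (annihilator W) f = x & `|f| < `|x| + e.
    by apply: quot_lift; rewrite ltrDl.
  rewrite quot_restrict_cproj; apply: le_trans (dual_restrict_norm_le f) _.
  exact: ltW.
have [f fx fN] := hahn_banach_extension (quot_restrict x).
have <- : cproj (annihilator W) f = x.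
  by apply: quot_restrict_inj; rewrite quot_restrict_cproj.
by apply: le_trans (cproj_norm_le _ _) _; rewrite quot_restrict_cproj fx.
Qed.

Lemma quot_restrict_surj (g : dual (csub W)) : exists x, quot_restrict x = g.
Proof.
have [f fg _] := hahn_banach_extension g.
by exists (cproj _ f); rewrite quot_restrict_cproj.
Qed.

End DualOfSubspace.

(** * The dual of a quotient as an annihilator *)

Section DualOfQuotient.
Context {R : realType} {E : normedModType R} (Z : closedSubmod E).

Lemma cproj_surj (x : cquot Z) : exists y, cproj Z y = x.
Proof. by exists (repr x); exact: cproj_repr. Qed.

Lemma le_quot_norm (x : cquot Z) (M r : R) : 0 <= M ->
  (forall y, cproj Z y = x -> r <= M * `|y|) -> r <= M * `|x|.
Proof.
move=> M0 rM; apply/ler_addgt0Pr => e e0.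
have e1 : 0 < e / (M + 1) by rewrite divr_gt0// ltr_wpDl.
have [y yx yN] : exists2 y, cproj Z y = x & `|y| < `|x| + e / (M + 1).
  by apply: quot_lift; rewrite ltrDl.
apply: le_trans (rM _ yx) _; apply: le_trans (ler_wpM2l M0 (ltW yN)) _.
rewrite mulrDr lerD2l mulrCA ler_piMr ?ltW//.
by rewrite ltr_pdivrMr ?ltr_wpDl// mul1r ltrDl.
Qed.

(** Since [f] vanishes on [Z], its value at the chosen representative is its value on the whole
    class. *)
Lemma annihilator_factor (f : csub (annihilator Z)) :
  exists g : dual (cquot Z), forall x, g (cproj Z x) = val f x.
Proof.
have fE x : val f (repr (cproj Z x)) = val f x.
  have /cprojP := cproj_repr (cproj Z x).
  have := valP f; rewrite inE => /= f0 /f0.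
  by rewrite raddfB => /eqP; rewrite subr_eq0 => /eqP.
have lf : linear (fun x : cquot Z => val f (repr x) : R^o).
  move=> a x y; have [x' <-] := cproj_surj x; have [y' <-] := cproj_surj y.
  by rewrite -linearP !fE linearP.
pose lm := GRing.isLinear.Build R _ R^o *:%R _ lf.
pose h : {linear cquot Z -> R^o} :=
  HB.pack (fun x : cquot Z => val f (repr x) : R^o) lm.
have [|g [gh _]] := linear_bounded_dual (f := h) (normr_ge0 (val f)).
  move=> x; apply: le_quot_norm => // y <-.
  by rewrite /= fE; exact: (ler_dual (val f) y).
by exists g => x; rewrite gh /= fE.
Qed.

Definition quot_functional (f : csub (annihilator Z)) : dual (cquot Z) :=
  sval (cid (annihilator_factor f)).

Lemma quot_functionalE f x : quot_functional f (cproj Z x) = val f x.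
Proof. exact: (svalP (cid (annihilator_factor f))). Qed.

Lemma quot_functional_linear : linear quot_functional.
Proof.
move=> a f g; apply: dual_eqP => x; have [y <-] := cproj_surj x.
rewrite dual_addE dual_scaleE !quot_functionalE [val _]linearP.
by rewrite dual_addE dual_scaleE.
Qed.

HB.instance Definition _ := GRing.isLinear.Build R (csub (annihilator Z))
  (dual (cquot Z)) *:%R quot_functional quot_functional_linear.

Lemma quot_functional_norm f : `|quot_functional f| = `|f|.
Proof.
apply/eqP; rewrite eq_le; apply/andP; split.
  apply: dual_norm_le => // x; apply: le_quot_norm => // y <-.
  by rewrite quot_functionalE; exact: (ler_dual (val f) y).
rewrite csub_normE; apply: dual_norm_le => // x; rewrite -quot_functionalE.
apply: le_trans (ler_dual _ _) _; rewrite ler_wpM2l//; exact: cproj_norm_le.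
Qed.

Lemma quot_functional_surj (g : dual (cquot Z)) : exists f, quot_functional f = g.
Proof.
have lg : linear (fun x => g (cproj Z x) : R^o) by move=> a x y; rewrite !linearP.
pose lm := GRing.isLinear.Build R E R^o *:%R _ lg.
pose h : {linear E -> R^o} := HB.pack (fun x => g (cproj Z x) : R^o) lm.
have [|f [fh _]] := linear_bounded_dual (f := h) (normr_ge0 g).
  move=> x; apply: le_trans (ler_dual _ _) _; rewrite ler_wpM2l//.
  exact: cproj_norm_le.
have Zf : f \in annihilator Z.
  rewrite inE => x xZ; rewrite fh /=.
  have -> : cproj Z x = 0 by rewrite -(raddf0 (cproj Z)); apply/cprojP; rewrite subr0.
  exact: raddf0.
exists (CSub Zf); apply: dual_eqP => x; have [y <-] := cproj_surj x.
by rewrite quot_functionalE fh.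
Qed.

Lemma csub_cone_annihilatorE (C : set E) :
  csub_cone (annihilator Z) (dual_cone C) =
  quot_functional @^-1` dual_cone (cproj Z @` C).
Proof.
apply/seteqP; split=> f fC; first by move=> _ [x Cx <-]; rewrite quot_functionalE fC.
by move=> x Cx; rewrite -quot_functionalE; apply: fC; exists x.
Qed.

End DualOfQuotient.

Theorem theorem3p5 (R : realType) (p : \bar R) (V : completeNormedModType R)
    (Vp : set V) (W : closedSubmod V) :
  (1 <= p)%E ->
  order_smooth p Vp ->
  [/\ (order_smooth (hoelder_conjugate p)
         (csub_cone (annihilator W) (dual_cone Vp))
       <->
       order_smooth p
         (quot_cone (annihilator W) (dual_cone (dual_cone Vp))) /\
       OSp2 p (quot_cone (annihilator W) (dual_cone (dual_cone Vp)))),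
      (order_smooth (hoelder_conjugate p) (quot_cone W (dual_cone Vp)) ->
       order_smooth p
         (csub_cone (annihilator (annihilator W)) (dual_cone (dual_cone Vp))) /\
       OSp2 p
         (csub_cone (annihilator (annihilator W)) (dual_cone (dual_cone Vp))))
    & (cproj (annihilator W) @` dual_cone Vp = quot_cone W (dual_cone Vp) ->
       order_smooth p
         (csub_cone (annihilator (annihilator W)) (dual_cone (dual_cone Vp))) ->
       order_smooth (hoelder_conjugate p) (quot_cone W (dual_cone Vp)))].
Proof.
move=> p1 osV; have pq : conjugate p (hoelder_conjugate p) by split.
have qp := conjugate_sym pq; move: (hoelder_conjugate p) pq qp => q pq qp.
have V0 := order_smooth0 osV.
have [cV _ _ clV O1V O2V] := osV.
set D := dual_cone Vp.
have [cD D0 clD] : [/\ cone D, D 0 & closed D].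
  split; [exact: dual_cone_cone|exact: dual_cone0|exact: dual_cone_closed].
have [cDD DD0 clDD] : [/\ cone (dual_cone D), dual_cone D 0 &
    closed (dual_cone D)].
  split; [exact: dual_cone_cone|exact: dual_cone0|exact: dual_cone_closed].
(* (O.p.1) reaches the bidual by dualizing twice, through the exact decompositions in the dual. *)
have O1DD : Op1 p (dual_cone D).
  exact: (Op2_dual_Op1 qp (OSp2_Op2 (Op1_dual_OSp2 pq cV V0 O1V))).
set Z := annihilator W.
pose incl (F : normedModType R) (X : closedSubmod F) : {linear csub X -> F} := val.
have inclN (F : normedModType R) (X : closedSubmod F) (x : csub X) :
  `|incl F X x| = `|x| by rewrite csub_normE.
split.
(* Part (i): the quotient of the bidual is the ordered dual of [csub Z], so both directions are the
   duality between [csub Z] and its dual. The converse uses completeness of [csub Z]. *)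
- have cX : cone (csub_cone Z D) := cone_preimage (T := incl _ Z) cD.
  have clX : closed (csub_cone Z D).
    exact: (isometry_closed_preimage (@inclN _ Z) clD).
  have X0 : csub_cone Z D 0 by rewrite -[_ 0]/(D (incl _ Z 0)) raddf0.
  rewrite (quot_cone_dual_coneP _ cD D0 clD); split=> [osX|[osQ _]].
    have [_ _ _ _ O1X O2X] := osX.
    have O2Q := OSp2_preimage (@quot_restrict_norm _ _ Z)
      (@quot_restrict_surj _ _ Z) (Op1_dual_OSp2 qp cX X0 O1X).
    split=> //; apply: (order_smoothI pq).
    + exact: (cone_preimage (@dual_cone_cone _ _ _)).
    + by rewrite /preimage/= raddf0; exact: dual_cone0.
    + apply: (isometry_closed_preimage (@quot_restrict_norm _ _ Z)).
      exact: dual_cone_closed.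
    + exact: (Op1_preimage (@quot_restrict_norm _ _ Z) (Op2_dual_Op1 qp O2X)).
    + exact: OSp2_Op2.
  have [_ _ _ _ O1Q O2Q] := osQ.
  apply: (order_smoothI qp) => //.
    apply: (dual_Op2_Op1 qp).
    exact: (Op2_of_preimage (@quot_restrict_norm _ _ Z)
      (@quot_restrict_surj _ _ Z) O2Q).
  apply: (dual_Op1_Op2 qp) => //.
    exact/csub_geo_complete/dual_geo_complete.
  exact: (Op1_of_preimage (@quot_restrict_norm _ _ Z)
    (@quot_restrict_surj _ _ Z) O1Q).
- move=> osY; have Y0 := order_smooth0 osY; have [cY _ _ _ O1Y _] := osY.
  (* Part (ii): decompositions exist in the dual of the weak* closed cone, and a functional
     nonnegative on the closure is nonnegative on the image. *)
  have OS2 : OSp2 p (csub_cone (annihilator Z) (dual_cone D)).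
    apply: (OSp2_sub (C := @quot_functional _ _ Z @^-1`
        dual_cone (quot_cone W D))); last first.
      apply: (OSp2_preimage (@quot_functional_norm _ _ Z)
        (@quot_functional_surj _ _ Z)).
      exact: (Op1_dual_OSp2 qp).
    rewrite csub_cone_annihilatorE => f fY x Dx; apply: fY.
    by apply: subset_closure; exists x.
  split=> //; apply: (order_smoothI pq).
  + exact: (cone_preimage (T := incl _ (annihilator Z)) cDD).
  + by rewrite -[_ 0]/(dual_cone D (incl _ (annihilator Z) 0)) raddf0.
  + exact: (isometry_closed_preimage (@inclN _ (annihilator Z)) clDD).
  + exact: (Op1_preimage (@inclN _ (annihilator Z)) O1DD).
  + exact: OSp2_Op2.
(* Part (iii): by [YE] the cone on the biannihilator is exactly the dual of the quotient cone, so
   both conditions can be pulled back to the quotient, which is complete. *)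
- move=> YE osX; have [_ _ _ _ O1X O2X] := osX.
  rewrite csub_cone_annihilatorE YE in O1X O2X.
  have QE := quot_cone_dual_coneP W cV V0 clV.
  have cY : cone (quot_cone W D).
    by rewrite QE; exact: (cone_preimage (@dual_cone_cone _ _ _)).
  have Y0 : quot_cone W D 0.
    by rewrite QE /preimage/= raddf0; exact: dual_cone0.
  have clY : closed (quot_cone W D).
    rewrite QE; apply: (isometry_closed_preimage (@quot_restrict_norm _ _ W)).
    exact: dual_cone_closed.
  apply: (order_smoothI qp) => //.
    apply: (dual_Op2_Op1 qp).
    exact: (Op2_of_preimage (@quot_functional_norm _ _ Z)
      (@quot_functional_surj _ _ Z) O2X).
  apply: (dual_Op1_Op2 qp) => //.
    exact/cquot_geo_complete/dual_geo_complete.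
  exact: (Op1_of_preimage (@quot_functional_norm _ _ Z)
    (@quot_functional_surj _ _ Z) O1X).
Qed.
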